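(* Let $(\phi_i)_{i\ge1}$ be an orthonormal system in $L_2([0,1])$ and let $(\lambda(i))_{i\ge1}$ be nonnegative numbers with $\Lambda:=\sum_{i=1}^\infty\lambda(i)^2<\infty$. For every integer $d\ge1$ let $$X_d(t)=\sum_{k\in\mathbb{N}^d}\ \prod_{l=1}^d\lambda(k_l)\ \prod_{l=1}^d\phi_{k_l}(t_l)\ \xi_k,\qquad t\in[0,1]^d,$$ where for each $d$ the $(\xi_k)_{k\in\mathbb{N}^d}$ are non-correlated random variables with zero mean and unit variance. Assume that $$M_2:=\sum_{i=1}^\infty|\ln\lambda(i)|^2\lambda(i)^2<\infty .$$ Then for any $\epsilon\in(0,1)$ there exist a sequence of positive integers $(m_d(\epsilon))_{d\ge1}$ and a sequence of linear approximation procedures $(A_d^\epsilon)_{d\ge1}$, where $A_d^\epsilon$ is based upon $m_d(\epsilon)$ point measurements of $X_d$, such that for any $d$ $$\mathbb{E}\|X_d-A_d^\epsilon X_d\|_2^2\le 3\epsilon^2\,\mathbb{E}\|X_d\|_2^2$$ and $$\lim_{d\to\infty}\frac{\ln m_d(\epsilon)-d\ln\Lambda_*}{\sqrt d}=2q_*,$$ where $$M:=-\sum_{i=1}^\infty\ln\lambda(i)\,\frac{\lambda(i)^2}{\Lambda},\qquad \Lambda_*:=\Lambda e^{2M},\qquad \sigma^2:=\frac{M_2}{\Lambda}-M^2,$$ and $q_*=q_*(\epsilon)$ is given by the equation $\hat\Phi(q_*/\sigma)=\epsilon^2$ with $\hat\Phi(x)=\frac{1}{\sqrt{2\pi}}\int_x^\infty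 e^{-u^2/2}\,du$.
   Context: $\mathbb{N}=\{1,2,\dots\}$; $\|\cdot\|_2$ is the norm of $L_2([0,1]^d)$ with Lebesgue measure, and $\mathbb{E}\|X_d\|_2^2=\Lambda^d$. Terms with $\lambda(i)=0$ contribute $0$ to the sums defining $M_2$ and $M$. The definition of $q_*$ presupposes $\Lambda>0$ and $\sigma>0$, with $\sigma$ the positive square root of $\sigma^2$. The series defining $X_d$ is the Karhunen--Loève expansion of a zero mean random field with covariance $\prod_{l=1}^dK(s_l,t_l)$, $K(s,t)=\sum_i\lambda(i)^2\phi_i(s)\phi_i(t)$; it converges in mean square, and $X_d$ is jointly measurable with sample paths considered as elements of $L_2([0,1]^d)$. A linear approximation procedure based upon $N$ point measurements is a map $Af=\sum_{l=1}^N f(\tau_l)\psi_l$ with fixed non-random points $\tau_l\in[0,1]^d$ and fixed non-random functions $\psi_l\in L_2([0,1]^d)$; these may depend on the distribution of $X_d$ but not on its realization. *)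

(* Defs.v *)
From HB Require Import structures.
From mathcomp Require Import all_boot all_order all_algebra finmap.
From mathcomp Require Import all_classical all_reals all_analysis.
From mathcomp.analysis.showcase Require summability.

Set Implicit Arguments.
Unset Strict Implicit.
Unset Printing Implicit Defensive.
Import Order.TTheory GRing.Theory Num.Theory.
Import numFieldNormedType.Exports.
Local Open Scope classical_set_scope.
Local Open Scope ring_scope.

(* L_2([0,1]) and L_2([0,1]^d) are rendered as Lfun with exponent 2 over the
   restriction of Lebesgue measure to the cube, carried by R and by d.-tuple R:
   a function on the cube is represented by a measurable extension of it, whose
   values off the cube do not matter. *)
Section unit_interval.
Variable R : realType.

Definition lebesgue01 : set (measurableTypeR R) -> \bar R :=
  mrestr (@lebesgue_measure R) (measurable_itv `[0%R, 1%R]).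

HB.instance Definition _ := Measure.on lebesgue01.

Let lebesgue01_setT : (lebesgue01 setT = 1)%E.
Proof.
by rewrite /lebesgue01 /mrestr setTI lebesgue_measure_itv /= lte_fin ltr01 oppr0
  adde0.
Qed.

HB.instance Definition _ :=
  Measure_isProbability.Build _ _ _ lebesgue01 lebesgue01_setT.

End unit_interval.

Section lebesgue_cube.
Context (R : realType).
Local Notation carrier := (measurableTypeR R).

Section step.
Context (n : nat) (mu : probability (n.-tuple carrier) R).

Definition lebesgue01_prod : set (carrier * n.-tuple carrier) -> \bar R :=
  (@lebesgue01 R \x mu)%E.

HB.instance Definition _ := Measure.on lebesgue01_prod.

Let lebesgue01_prod_setT : (lebesgue01_prod setT = 1)%E.
Proof.
rewrite /lebesgue01_prod -setXTT product_measure1E//.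
by rewrite [X in (X * _)%E]probability_setT [X in (_ * X)%E]probability_setT
  mule1.
Qed.

HB.instance Definition _ := Measure_isProbability.Build _ _ _
  lebesgue01_prod lebesgue01_prod_setT.

Definition tuple_cons (p : carrier * n.-tuple carrier) : n.+1.-tuple carrier :=
  [the n.+1.-tuple carrier of p.1 :: p.2].

Let measurable_tuple_cons : measurable_fun setT tuple_cons.
Proof. exact: measurable_cons measurable_fst measurable_snd. Qed.

HB.instance Definition _ :=
  isMeasurableFun.Build _ _ _ _ tuple_cons measurable_tuple_cons.

End step.

(* Lebesgue measure on [0,1]^d, as the d-fold product of lebesgue01. *)
Fixpoint lebesgue_cube (d : nat) : probability (d.-tuple carrier) R :=
  match d with
  | 0 => \d_([tuple] : 0.-tuple carrier)
  | n.+1 => distribution (lebesgue01_prod (lebesgue_cube n)) (@tuple_cons n)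
  end.

End lebesgue_cube.

Section field.
Context (R : realType).
Local Notation carrier := (measurableTypeR R).

Definition orthonormal01 (phi : nat -> R -> R) : Prop :=
  (forall i, phi i \in Lfun (@lebesgue01 R) 2%:E) /\
  (forall i j,
     (\int[@lebesgue01 R]_x (phi i x * phi j x)%:E = ((i == j)%:R)%:E)%E).

Definition white_noise (disp : measure_display) (T : measurableType disp)
    (P : probability T R) (I : eqType) (xi : I -> {RV P >-> R}) : Prop :=
  [/\ forall k, (xi k : T -> R) \in Lfun P 2%:E,
      forall k, ('E_P[xi k] = 0)%E,
      forall k, ('V_P[xi k] = 1)%E
    & forall k l, k != l -> (covariance P (xi k) (xi l) = 0)%E].

(* Unordered sum in mean square: [totally] is the filter of finite sets of
   indices directed by inclusion. *)
Definition mean_square_sum (disp : measure_display) (T : measurableType disp)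
    (P : probability T R) (I : choiceType) (f : I -> T -> R) (Y : T -> R) :
    Prop :=
  (fun F : {fset I} => 'E_P[fun w => ((Y w - \sum_(k <- F) f k w) ^+ 2)%R]%E)
    @ @summability.totally I --> (0 : \bar R).

(* Sequences indexed by {1, 2, ...} are indexed by nat from 0, and a
   multi-index of N^d is a d-tuple of such indices.  The phi i being elements
   of L_2([0,1]), hence determined up to a null set, the expansion is required
   at almost every t. *)
Definition KL_field (lam : nat -> R) (phi : nat -> R -> R) (d : nat)
    (disp : measure_display) (T : measurableType disp) (P : probability T R)
    (xi : d.-tuple nat -> {RV P >-> R}) (X : T -> d.-tuple carrier -> R) :
    Prop :=
  measurable_fun setT (fun p : T * d.-tuple carrier => X p.1 p.2) /\
  {ae lebesgue_cube R d, forall t, mean_square_sum P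
    (fun k w => (\prod_(l < d) lam (tnth k l)) *
                (\prod_(l < d) phi (tnth k l) (tnth t l)) * xi k w)
    (fun w => X w t)}.

Record point_procedure (d N : nat) := PointProcedure {
  node : 'I_N -> d.-tuple carrier;
  node_cube : forall l i, tnth (node l) i \in `[0, 1];
  weight : 'I_N -> d.-tuple carrier -> R;
  weight_L2 : forall l, weight l \in Lfun (lebesgue_cube R d) 2%:E }.

Definition proc_map (d N : nat) (A : point_procedure d N)
    (f : d.-tuple carrier -> R) : d.-tuple carrier -> R :=
  fun t => \sum_(l < N) f (node A l) * weight A l t.

Definition mean_sqnorm (d : nat) (disp : measure_display)
    (T : measurableType disp) (P : probability T R)
    (Y : T -> d.-tuple carrier -> R) : \bar R :=
  (\int[P]_w 'N[lebesgue_cube R d]_2%:E[EFin \o Y w] ^+ 2)%E.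

End field.

(* The library sets ln 0 = 0, so that the terms with lam i = 0 vanish. *)
Section constants.
Context (R : realType) (lam : nat -> R).

Definition Lambda : R := limn (series (fun i => lam i ^+ 2)).

Definition M2_terms : R^nat := fun i => `|ln (lam i)| ^+ 2 * lam i ^+ 2.

Definition M2 : R := limn (series M2_terms).

Definition M : R :=
  - limn (series (fun i => ln (lam i) * (lam i ^+ 2 / Lambda))).

Definition Lambda_star : R := Lambda * expR (2 * M).

Definition sigma2 : R := M2 / Lambda - M ^+ 2.

Definition sigma : R := Num.sqrt sigma2.

End constants.

Definition Phihat (R : realType) (x : R) : R :=
  (Num.sqrt (2 * pi))^-1 *
  \int[@lebesgue_measure R]_(u in `[x, +oo[) expR (- (u ^+ 2 / 2)).

(* Main.v *)
From HB Require Import structures.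
Require Import Defs.
From mathcomp Require Import all_boot all_order all_algebra finmap.
From mathcomp Require Import all_classical all_reals all_analysis.
From mathcomp Require Import measurable_realfun.
From mathcomp Require Import ring lra.
Import Order.TTheory GRing.Theory Num.Theory.
Import numFieldNormedType.Exports.

(** Two facts carry the proof.

    Point values are almost as good as Fourier coefficients.  Let V be the
    mean squared norm of X and let F be a set of n multi-indices whose
    eigenvalues, the squares of the products of the lam (k_l), leave a tail of
    at most eps^2 V.  Projecting X on the tensors phi_k, k in F, costs
    eps^2 V, but uses the coefficients z_k = <X, phi_k>.
    Let W = sum_(k in F) phi_k^2.  For a random point t of density W/n, the
    number n X(t) phi_k(t) / W(t) is an unbiased estimate of z_k, and over
    all k in F these estimates have total variance at most n V.  Averaging N
    of them gives an error of order (n/N) V.  Deterministic points are chosen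
    one at a time ([greedy_point]): given the previous ones, the new squared
    error, averaged over t, exceeds the old one by at most n V, so some t in
    the cube does at most 2 n V worse.  With N >= n / eps^2
    the total is at most 3 eps^2 V ([sampling_error], [exists_procedure]).
    The mean-square expansion enters only through the identity
    [truncation_error]: dropping the terms outside F costs exactly the tail
    of the eigenvalues; for F empty this gives V = Lambda^d.

    The number of multi-indices is governed by the central limit theorem.
    Under the product of the weights p_i = lam(i)^2 / Lambda, the variables
    - ln lam(k_l) are independent with mean M and variance sigma^2.  The
    indices k with - sum_l ln lam(k_l) <= d M + y sqrt d number at most
    Lambda^d exp(2 (d M + y sqrt d)), since each carries an eigenvalue of at
    least exp(-2 (d M + y sqrt d)), and for y > q their tail is eventually at
    most eps^2 Lambda^d ([tail_index_set]).  So the minimal cardinality n_d is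
    eventually at most exp(d ln Lambda_star + 2 y sqrt d) for every y > q.
    Extra sampling points do no harm, so m_d is taken to be the larger of
    n_d / eps^2 and exp(d ln Lambda_star + 2 q sqrt d), up to rounding, and
    has the right growth from below by construction ([sampling_sizes]).

    The tail estimate is the upper half of the central limit theorem
    ([clt_tail]), proved by Lindeberg's replacement argument with the test
    function v(rho, x) = Phihat (x / sqrt rho).  As this is an explicit
    solution of the heat equation, replacing one summand by a Gaussian one
    amounts to adding its variance to rho ([lindeberg_step]). *)

Set Implicit Arguments.
Unset Strict Implicit.
Unset Printing Implicit Defensive.
Local Open Scope classical_set_scope.
Local Open Scope ring_scope.

(** * The Gaussian tail function *)

Section gaussian_tail.
Context {R : realType}.
Implicit Types x y w : R.

Local Notation mu := (@lebesgue_measure R).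

Definition gauss_density x : R :=
  (Num.sqrt (2 * pi))^-1 * expR (- (x ^+ 2 / 2)).

Lemma gauss_densityE : gauss_density = normal_pdf 0 1.
Proof.
apply/funext => x; rewrite normal_pdfE ?oner_eq0// /normal_peak /normal_fun.
by rewrite /gauss_density subr0 expr1n mul1r (mulr_natl pi 2) mulNr.
Qed.

Lemma gauss_density_gt0 x : 0 < gauss_density x.
Proof.
by rewrite mulr_gt0 ?expR_gt0// invr_gt0 sqrtr_gt0 mulr_gt0 ?pi_gt0.
Qed.

Lemma integrable_gauss_density (A : set (measurableTypeR R)) : measurable A ->
  mu.-integrable A (EFin \o gauss_density).
Proof.
move=> mA; rewrite gauss_densityE.
by apply: integrableS (integrable_normal_pdf 0 1).
Qed.

Lemma PhihatE x : Phihat x = \int[mu]_(u in `[x, +oo[) gauss_density u.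
Proof.
rewrite /Phihat -RintegralZl//.
have c0 : (Num.sqrt (2 * pi) : R) != 0 by rewrite gt_eqF// sqrtr_gt0 mulr_gt0
    ?pi_gt0.
have mA : measurable (`[x, +oo[ : set (measurableTypeR R)) by [].
have := integrableZl mA (Num.sqrt (2 * pi)) (integrable_gauss_density mA).
apply: eq_integrable => // u _ /=.
by rewrite -EFinM /gauss_density mulrA divff// mul1r.
Qed.

(** The integral over a left half-line is the form to which the
    fundamental theorem of calculus applies. *)
Lemma Phihat_lower x :
  Phihat x = 1 - \int[mu]_(u in `]-oo, x]) gauss_density u.
Proof.
have -> : (1 : R) = \int[mu]_u gauss_density u.
  by rewrite /Rintegral gauss_densityE integral_normal_pdf.
have -> : [set: R] = `]-oo, x] `|` `]x, +oo[.
  apply/seteqP; split => // u _ /=; rewrite !in_itv/= andbT.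
  by case: leP => _; [left|right].
rewrite Rintegral_setU//=; last 2 first.
- exact/integrable_gauss_density/measurableU.
- apply/disj_setPS => u [] /=; rewrite !in_itv/= andbT => ux xu.
  by move: (le_lt_trans ux xu); rewrite ltxx.
rewrite PhihatE addrC addKr Rintegral_itv_obnd_cbnd//.
exact: integrable_gauss_density.
Qed.

Lemma continuous_gauss_density : continuous gauss_density.
Proof. by rewrite gauss_densityE; apply: continuous_normal_pdf;
    rewrite oner_eq0. Qed.

Lemma is_derive_Phihat x : is_derive x 1 (@Phihat R) (- gauss_density x).
Proof.
have xx1 : x < x + 1 by rewrite ltrDl.
have [dF F'] := @continuous_FTC1 _ gauss_density -oo%O x (x + 1) xx1
  (integrable_gauss_density (measurable_itv _)) (ltNyr _)
  (@continuous_gauss_density x).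
have -> : @Phihat R = cst 1 - (fun y => \int[mu]_(u in `]-oo, y]) gauss_density
    u).
  by apply/funext => y; rewrite Phihat_lower.
rewrite derive1E in F'; have H := DeriveDef dF F'.
by apply: is_derive_eq; rewrite sub0r.
Qed.

Lemma Phihat_ge0 x : 0 <= Phihat x.
Proof. by rewrite PhihatE; apply: Rintegral_ge0 => u _;
    rewrite ltW ?gauss_density_gt0. Qed.

Lemma cvg_PhihatNy : Phihat x @[x --> -oo] --> (1 : R).
Proof.
pose P := [the probability _ R of normal_prob (0:R) 1].
pose X : measurableTypeR R -> R := idfun.
pose X' : {RV P >-> R} := HB.pack X
  (@isMeasurableFun.Build _ _ _ _ X (@measurable_id _ _ setT)).
have := cvg_ccdfNy1 X'.
rewrite (_ : ccdf X' = EFin \o @Phihat R).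
  by move/fine_cvgP => [_].
apply/funext => x /=.
rewrite /ccdf /distribution /pushforward preimage_id /P /normal_prob.
rewrite PhihatE -Rintegral_itv_obnd_cbnd; last exact: integrable_gauss_density.
rewrite /Rintegral fineK; first by rewrite gauss_densityE.
by apply: integrable_fin_num => //; exact: integrable_gauss_density.
Qed.

Lemma is_derive_gauss_density x :
  is_derive x 1 gauss_density (- x * gauss_density x).
Proof.
rewrite /gauss_density; apply: is_derive_eq.
by rewrite /GRing.scale /=; set c := _^-1; field.
Qed.

Lemma Phihat_lt x y : x < y -> Phihat y < Phihat x.
Proof.
move=> xy.
have [|c _ E] := @MVT _ (@Phihat R) (fun x => - gauss_density x) x y xy
  (fun z _ => is_derive_Phihat z).
  by apply: derivable_within_continuous => z _; have [] := is_derive_Phihat z.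
by rewrite -subr_lt0 E pmulr_llt0 ?subr_gt0// oppr_lt0 gauss_density_gt0.
Qed.

Lemma Phihat_le x y : x <= y -> Phihat y <= Phihat x.
Proof. by rewrite le_eqVlt => /predU1P[->//|/Phihat_lt/ltW]. Qed.

Lemma continuous_Phihat : continuous (@Phihat R).
Proof.
move=> x; apply/differentiable_continuous/derivable1_diffP.
by have [] := is_derive_Phihat x.
Qed.

(** One bound that controls every product of the Gaussian density with a
    polynomial of degree at most four: from t e^(-t) <= 1 one gets
    x^2 e^(-x^2/2) <= 2 and x^4 e^(-x^2/2) <= 16, and 1 + 2 + 16 = 19. *)
Lemma gauss_density_poly x : (1 + x ^+ 2 + x ^+ 4) * gauss_density x <= 19.
Proof.
have c1 : (Num.sqrt (2 * pi) : R)^-1 <= 1.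
  rewrite invf_le1 ?sqrtr_gt0 ?mulr_gt0 ?pi_gt0//.
  by rewrite -[X in X <= _]sqrtr1 ler_sqrt ?mulr_ge0 ?pi_ge0//;
    have := @pi_ge2 R; lra.
have exp_bound (t : R) : 0 <= t -> t * expR (- t) <= 1.
  move=> t0; rewrite expRN ler_pdivrMr ?expR_gt0// mul1r.
  by apply: le_trans (expR_ge1Dx t); rewrite lerDr.
have x2 : 0 <= x ^+ 2 / 2 by rewrite divr_ge0 ?sqr_ge0.
have x4 : 0 <= x ^+ 2 / 4 by rewrite divr_ge0 ?sqr_ge0.
have e1 : expR (- (x ^+ 2 / 2)) <= 1.
  by rewrite expR_le1 oppr_le0.
have e2 := exp_bound _ x2.
have e4 := exp_bound _ x4.
have e0 : 0 < expR (- (x ^+ 2 / 2)) by exact: expR_gt0.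
have e44 : expR (- (x ^+ 2 / 2)) = expR (- (x ^+ 2 / 4)) ^+ 2.
  by rewrite [RHS]expr2 -expRD; congr expR; field.
have e5 : (x ^+ 2 / 4 * expR (- (x ^+ 2 / 4))) ^+ 2 <= 1.
  by rewrite expr_le1// mulr_ge0// expR_ge0.
rewrite exprMn -e44 in e5.
rewrite /gauss_density mulrCA.
apply: (@le_trans _ _ ((1 + x ^+ 2 + x ^+ 4) * expR (- (x ^+ 2 / 2)))).
  rewrite ler_piMl// mulr_ge0 ?ltW//.
  by have := sqr_ge0 x; have := sqr_ge0 (x ^+ 2); rewrite -exprM; lra.
have -> : (1 + x ^+ 2 + x ^+ 4) * expR (- (x ^+ 2 / 2)) =
  expR (- (x ^+ 2 / 2)) + 2 * (x ^+ 2 / 2 * expR (- (x ^+ 2 / 2))) +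
  16 * ((x ^+ 2 / 4) ^+ 2 * expR (- (x ^+ 2 / 2))) by field.
by lra.
Qed.

End gaussian_tail.

(** * Taylor estimates *)

Section taylor.
Context {R : realType}.
Implicit Types (f : R -> R) (a b x e K : R).

Lemma mean_value f df a b : (forall x, is_derive x 1 f (df x)) ->
  exists2 c, `|c - a| <= `|b - a| & f b - f a = df c * (b - a).
Proof.
move=> fdf.
have cf u v : {within `[u, v], continuous f}.
  by apply: derivable_within_continuous => z _; have [] := fdf z.
have [ab|/ltW ba] := leP a b.
  have [//|c /[!in_itv]/= /andP[ac cb] E] :=
    @MVT_segment _ f df a b ab (fun x _ => fdf x).
  by exists c => //; rewrite !ger0_norm ?subr_ge0// lerB.
have [//|c /[!in_itv]/= /andP[ac cb] E] :=
  @MVT_segment _ f df b a ba (fun x _ => fdf x).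
exists c; first by rewrite !ler0_norm ?subr_le0// lerN2 lerB.
by rewrite -opprB E -mulrN opprB.
Qed.

(** The mean value theorem is applied once for each derivative, whence the
    constants here and in [taylor2_le], which are not the optimal ones. *)
Lemma taylor1_le f f1 f2 x e K : (forall x, is_derive x 1 f (f1 x)) ->
    (forall x, is_derive x 1 f1 (f2 x)) -> (forall x, `|f2 x| <= K) ->
  `|f (x + e) - f x - f1 x * e| <= K * e ^+ 2.
Proof.
move=> d1 d2 f2K.
have [c] := mean_value x (x + e) d1; rewrite addrAC subrr add0r => ce ->.
have [c'] := mean_value x c d2 => c'c E.
rewrite -mulrBl E -mulrA !normrM -[e ^+ 2]ger0_norm ?sqr_ge0// expr2 normrM.
by rewrite ler_pM ?mulr_ge0// ler_wpM2r.
Qed.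

Lemma taylor2_le f f1 f2 f3 x e K : (forall x, is_derive x 1 f (f1 x)) ->
    (forall x, is_derive x 1 f1 (f2 x)) -> (forall x, is_derive x 1 f2 (f3 x))
        ->
    (forall x, `|f3 x| <= K) ->
  `|f (x + e) - f x - f1 x * e - f2 x * e ^+ 2 / 2| <= K * `|e| ^+ 3.
Proof.
move=> d1 d2 d3 f3K.
pose h t := f (x + t) - f x - f1 x * t - f2 x * t ^+ 2 / 2.
pose h1 t := f1 (x + t) - f1 x - f2 x * t.
have dshift (k k1 : R -> R) (t : R) : (forall x, is_derive x 1 k (k1 x)) ->
    is_derive t 1 (fun t => k (x + t)) (k1 (x + t)).
  move=> dk; have sh : is_derive t (1 : R) (fun t => x + t) (1 : R).
    have := is_deriveD (is_derive_cst x t (1 : R)) (is_derive_id t (1 : R)).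
    by rewrite add0r.
  by have := @is_derive1_comp _ k (fun t => x + t) t _ _ (dk _) sh;
    rewrite mulr1.
have dh (t : R) : is_derive t 1 h (h1 t).
  have H := dshift f f1 t d1.
  rewrite /h; apply: is_derive_eq.
  by rewrite /h1 /GRing.scale /=; field.
have [c] := mean_value 0 e dh; rewrite !subr0 => ce hE.
have -> : f (x + e) - f x - f1 x * e - f2 x * e ^+ 2 / 2 = h1 c * e.
  rewrite -hE {2}/h addr0 expr0n/= subrr !mulr0 mul0r !subr0 //.
rewrite normrM exprSr mulrA ler_wpM2r//.
apply: le_trans (taylor1_le x c d2 d3 f3K) _.
rewrite ler_wpM2l//; first exact: le_trans (normr_ge0 _) (f3K x).
by rewrite -real_normK ?num_real// ler_sqr ?nnegrE.
Qed.

End taylor.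

(** * The Gaussian tail along the heat flow *)

Section gaussian_heat.
Context {R : realType}.
Implicit Types x y w e t : R.

(** The minimum is what makes Lindeberg's method work for laws of finite
    variance: the second-order bound serves for large e, the third-order bound
        for
    small e. *)
Lemma Phihat_taylor w e :
  Phihat (w + e) <= Phihat w - gauss_density w * e
    + w * gauss_density w * e ^+ 2 / 2 + 38 * (e ^+ 2 * Num.min 1 `|e|).
Proof.
pose g := @gauss_density R.
pose f2 x := x * g x; pose f3 x := (1 - x ^+ 2) * g x.
have d1 x : is_derive x 1 (@Phihat R) (- g x) by exact: is_derive_Phihat.
have dg x : is_derive x 1 g (- x * g x) by exact: is_derive_gauss_density.
have d2 x : is_derive x 1 (fun x => - g x) (f2 x).
  by apply: is_derive_eq; rewrite mulNr opprK.
have d3 x : is_derive x 1 f2 (f3 x).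
  by apply: is_derive_eq; rewrite /f3 /GRing.scale /=; ring.
have g0 x : 0 < g x by exact: gauss_density_gt0.
have f2K x : `|f2 x| <= 19.
  apply: le_trans (gauss_density_poly x); rewrite normrM (gtr0_norm (g0 x)).
  rewrite ler_pM2r ?g0//.
  have := sqr_ge0 (`|x| - 1); have := sqr_ge0 (x ^+ 2).
  have : `|x| ^+ 2 = x ^+ 2 by rewrite real_normK ?num_real.
  by have := sqr_ge0 x; nra.
have f3K x : `|f3 x| <= 19.
  apply: le_trans (gauss_density_poly x); rewrite normrM (gtr0_norm (g0 x)).
  rewrite ler_pM2r ?g0// ler_norml.
  by have := sqr_ge0 (x ^+ 2); have := sqr_ge0 x; lra.
have T1 := taylor1_le w e d1 d2 f2K.
have T2 := taylor2_le w e d1 d2 d3 f3K.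
have [_|_] := leP 1 `|e|.
  move: T1; rewrite ler_norml => /andP[_].
  have : - 19 * e ^+ 2 <= f2 w * e ^+ 2.
    by rewrite ler_wpM2r ?sqr_ge0//; have := f2K w;
      rewrite ler_norml => /andP[].
  by rewrite -/g /f2 mulr1; have := sqr_ge0 e; lra.
move: T2; rewrite ler_norml => /andP[_].
have -> : `|e| ^+ 3 = e ^+ 2 * `|e| by rewrite exprSr real_normK ?num_real.
have : 0 <= e ^+ 2 * `|e| by rewrite mulr_ge0 ?sqr_ge0.
by rewrite -/g /f2; lra.
Qed.

(** Multiplying the variance by 1 + t changes Phihat at first order by
    half of t times its second derivative w g(w), as the heat equation
    predicts.  The proof uses the parameter s = ln (1 + t) / 2, in which the
    dilation is w e^(-s) and the derivatives are again polynomials times the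
    density. *)
Lemma Phihat_dilate w t : 0 <= t ->
  Phihat w + w * gauss_density w * t / 2 - 15 * t ^+ 2
    <= Phihat (w / Num.sqrt (1 + t)).
Proof.
move=> t0; pose g := @gauss_density R.
pose W s := w * expR (- s).
have g0 x : 0 < g x by exact: gauss_density_gt0.
have dg x : is_derive x 1 g (- x * g x) by exact: is_derive_gauss_density.
have dW (s : R) : is_derive s 1 W (- W s).
  by apply: is_derive_eq; rewrite /W /GRing.scale /=; ring.
have dk (x : R) : is_derive x 1 (fun x => x * g x) ((1 - x ^+ 2) * g x).
  by apply: is_derive_eq; rewrite /GRing.scale /=; ring.
have d1 (s : R) : is_derive s 1 (@Phihat R \o W) (W s * g (W s)).
  have H : is_derive (W s) 1 (@Phihat R) (- g (W s)) by exact: is_derive_Phihat.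
  by have := is_derive1_comp H (dW s); rewrite mulrNN mulrC.
have d2 (s : R) : is_derive s 1 (fun s => W s * g (W s))
    ((1 - W s ^+ 2) * g (W s) * - W s).
  exact: is_derive1_comp (dk (W s)) (dW s).
have K (s : R) : `|(1 - W s ^+ 2) * g (W s) * - W s| <= 19.
  apply: le_trans (gauss_density_poly (W s)).
  rewrite mulrAC normrM (gtr0_norm (g0 _)) ler_pM2r ?g0// normrM normrN.
  set v := W s.
  have v2 : `|v| ^+ 2 = v ^+ 2 by rewrite real_normK ?num_real.
  have v4 : v ^+ 4 = `|v| ^+ 4 by rewrite (exprM v 2 2) -v2 -exprM.
  have : `|1 - v ^+ 2| <= 1 + v ^+ 2.
    by rewrite ler_norml; have := sqr_ge0 v; lra.
  have := normr_ge0 v; rewrite -v2 v4; move: `|v| `|1 - _| => a b a0 ab.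
  apply: (@le_trans _ _ ((1 + a ^+ 2) * a)); first by rewrite ler_wpM2r.
  have := sqr_ge0 (a - 1); have := sqr_ge0 (a ^+ 2 - a).
  by have := sqr_ge0 a; have := sqr_ge0 (a ^+ 2); nra.
pose th := ln (1 + t) / 2.
have := taylor1_le 0 th d1 d2 K; rewrite add0r /= ler_norml => /andP[+ _].
have -> : W 0 = w by rewrite /W oppr0 expR0 mulr1.
have -> : W th = w / Num.sqrt (1 + t).
  have t1 : 0 < 1 + t by lra.
  rewrite /W expRN; congr (_ / _).
  apply/eqP; rewrite -(@eqrXn2 _ 2) ?expR_ge0 ?sqrtr_ge0// sqr_sqrtr; last lra.
  by rewrite expr2 -expRD /th -splitr lnK.
have th_le : th <= t / 2.
  by rewrite /th ler_pM2r// le_ln1Dx//; lra.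
have th_ge : (t - t ^+ 2) / 2 <= th.
  rewrite /th ler_pM2r// -lerN2 -lnV ?posrE; last by lra.
  have i0 : 0 < (1 + t)^-1 by rewrite invr_gt0; lra.
  apply: (@le_trans _ _ ((1 + t)^-1 - 1)).
    rewrite -[X in ln X](_ : 1 + ((1 + t)^-1 - 1) = _);
        last by rewrite addrCA subrr addr0.
    by apply: le_ln1Dx; lra.
  rewrite lerBlDr -div1r ler_pdivrMr; last lra.
  have : 0 <= t ^+ 3 by rewrite exprn_ge0.
  rewrite !exprS expr0; nra.
have th0 : 0 <= th by rewrite /th divr_ge0// ln_ge0//; lra.
have th2 : th ^+ 2 <= t ^+ 2 / 4.
  have -> : t ^+ 2 / 4 = (t / 2) ^+ 2 by field.
  by rewrite ler_sqr ?nnegrE//; lra.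
have wg : `|w * g w| <= 19.
  apply: le_trans (gauss_density_poly w); rewrite normrM (gtr0_norm (g0 w)).
  rewrite ler_pM2r ?g0//.
  have := sqr_ge0 (`|w| - 1); have := sqr_ge0 (w ^+ 2).
  have : `|w| ^+ 2 = w ^+ 2 by rewrite real_normK ?num_real.
  by have := sqr_ge0 w; nra.
have : w * g w * (t / 2 - th) <= 19 * (t ^+ 2 / 2).
  apply: (@le_trans _ _ (19 * (t / 2 - th))).
    rewrite ler_wpM2r//; first lra.
    exact: le_trans (ler_norm _) wg.
  by lra.
rewrite -/g mulrBr; lra.
Qed.

End gaussian_heat.

(** * Replacing one summand by a Gaussian *)

Section lindeberg.
Context {R : realType}.

Lemma esum_le_series (f b : nat -> R) (B : R) :
  (forall i, 0 <= f i <= b i) -> series b @ \oo --> B ->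
  (\esum_(i in [set: nat]) (f i)%:E <= B%:E)%E.
Proof.
move=> fb bB; rewrite -nneseries_esumT; last first.
  by move=> i; rewrite lee_fin; have /andP[] := fb i.
apply: lime_le.
  by apply: is_cvg_nneseries => i _; rewrite lee_fin; have /andP[] := fb i.
apply: nearW => n; rewrite sumEFin lee_fin.
apply: (@le_trans _ _ (series b n)).
  by apply: ler_sum => i _; have /andP[] := fb i.
rewrite -(cvg_lim _ bB)//; apply: nondecreasing_cvgn_le.
  apply: nondecreasing_series => i _ _.
  by have /andP[f0 /(le_trans f0)] := fb i.
by apply/cvg_ex; exists B.
Qed.

Variables (p a : nat -> R) (s2 : R).
Hypothesis p_ge0 : forall i, 0 <= p i.
Hypothesis p_sum : series p @ \oo --> (1 : R).
Hypothesis a_mean : series (fun i => p i * a i) @ \oo --> (0 : R).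
Hypothesis a_var : series (fun i => p i * a i ^+ 2) @ \oo --> s2.

(** The Lindeberg term: it is at most the variance and, for bounded
    values, at most linear in u. *)
Definition truncated_var (u : R) (i : nat) : R :=
  p i * a i ^+ 2 * Num.min 1 (u * `|a i|).

Lemma truncated_var_ge0 (u : R) i : 0 <= u -> 0 <= truncated_var u i.
Proof.
move=> u0; rewrite /truncated_var mulr_ge0//.
  by rewrite mulr_ge0 ?sqr_ge0.
by rewrite le_min ler01 mulr_ge0.
Qed.

(** All but finitely many terms contribute at most e to the variance, and the
    remaining ones are at most linear in u. *)
Lemma truncated_var_small (e : R) : 0 < e -> exists2 C, 0 <= C &
  forall u, 0 <= u -> cvgn (series (truncated_var u)) /\
                      limn (series (truncated_var u)) <= e + C * u.
Proof.
move=> e0; pose b i := p i * a i ^+ 2.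
have b0 i : 0 <= b i by rewrite mulr_ge0 ?sqr_ge0.
have nd_b : nondecreasing_seq (series b) by apply: nondecreasing_series.
have cb : cvgn (series b) by apply/cvg_ex; exists s2.
have b_le n : series b n <= s2.
  by rewrite -(cvg_lim _ a_var)//; apply: nondecreasing_cvgn_le.
have [N bN] : exists N, s2 - e <= series b N.
  have /cvgrPdist_le /(_ _ e0)[N _ /(_ N (leqnn N))] := a_var.
  rewrite ler_norml => /andP[_]; rewrite -/b => H; exists N; lra.
exists (\sum_(0 <= i < N) p i * `|a i| ^+ 3).
  by apply: sumr_ge0 => i _; rewrite mulr_ge0.
move=> u u0.
have t0 i : 0 <= truncated_var u i by exact: truncated_var_ge0.
have t_le1 i : truncated_var u i <= b i.
  by rewrite /truncated_var ler_piMr ?b0// ge_min lexx.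
have t_le2 i : truncated_var u i <= p i * `|a i| ^+ 3 * u.
  have -> : p i * `|a i| ^+ 3 * u = b i * (u * `|a i|).
    by rewrite exprSr real_normK ?num_real// /b; ring.
  by rewrite /truncated_var ler_wpM2l ?b0// ge_min lexx orbT.
have nd_t : nondecreasing_seq (series (truncated_var u)).
  exact: nondecreasing_series.
have t_le n : series (truncated_var u) n <= e +
    (\sum_(0 <= i < N) p i * `|a i| ^+ 3) * u.
  apply: (@le_trans _ _ (series (truncated_var u) (N + n))).
    exact/nd_t/leq_addl.
  rewrite /series /= (@big_cat_nat _ _ _ N)//= ?leq_addr// addrC lerD//.
    apply: (@le_trans _ _ (\sum_(N <= i < N + n) b i)); first exact: ler_sum.
    have := b_le (N + n)%N; rewrite /series/= (@big_cat_nat _ _ _ N)//=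
        ?leq_addr//.
    by move: bN; rewrite /series/=; lra.
  by rewrite mulr_suml; apply: ler_sum.
have ct : cvgn (series (truncated_var u)).
  by apply: nondecreasing_is_cvgn => //; eexists => _ [n _ <-]; exact: t_le.
by split=> //; apply: limr_le => //; exact: nearW.
Qed.

(** The solution of the heat equation, in the time rho, whose initial value is
    the indicator of the negative half-line. *)
Definition heat (rho x : R) : R := Phihat (x / Num.sqrt rho).

(** The first-order term of the Taylor expansion vanishes because the law is
    centred; the second-order term is, by the heat equation, the effect of
    increasing the variance rho by s2 h. *)
Lemma lindeberg_step (rho0 rho h x C e : R) :
  0 < rho0 -> rho0 <= rho -> 0 <= h -> 0 <= C ->
  (forall u, 0 <= u -> cvgn (series (truncated_var u)) /\
                      limn (series (truncated_var u)) <= e + C * u) ->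
  (\esum_(i in [set: nat]) (p i * heat rho (x - Num.sqrt h * a i))%:E <=
   (heat (rho + s2 * h) x + 15 * (s2 * h / rho0) ^+ 2 +
      38 * ((h / rho0) * (e + C * Num.sqrt (h / rho0))))%:E)%E.
Proof.
move=> rho00 rho0rho h0 C0 HC.
have rhop : 0 < rho by exact: lt_le_trans rho0rho.
pose w := x / Num.sqrt rho; pose u := Num.sqrt (h / rho).
pose g := gauss_density w.
have u2 : u ^+ 2 = h / rho by rewrite sqr_sqrtr// divr_ge0// ltW.
have u0 : 0 <= u by rewrite sqrtr_ge0.
have us : Num.sqrt h / Num.sqrt rho = u by rewrite /u sqrtrM// sqrtrV ?ltW.
have s20 : 0 <= s2.
  rewrite -(cvg_lim _ a_var)//; apply: limr_ge; first by apply/cvg_ex;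
      exists s2.
  apply: nearW => n; apply: sumr_ge0 => i _; by rewrite mulr_ge0 ?sqr_ge0.
have [ct tle] := HC _ u0; set L := limn _ in tle.
pose b i := p i * Phihat w + g * u * (p i * a i)
  + (w * g * u ^+ 2 / 2) * (p i * a i ^+ 2) + 38 * u ^+ 2 * truncated_var u i.
pose B := Phihat w + w * g * u ^+ 2 / 2 * s2 + 38 * u ^+ 2 * L.
have bB : series b @ \oo --> B.
  rewrite (_ : series b = fun n => series p n * Phihat w
    + g * u * series (fun i => p i * a i) n
    + (w * g * u ^+ 2 / 2) * series (fun i => p i * a i ^+ 2) n
    + 38 * u ^+ 2 * series (truncated_var u) n); last first.
    by apply/funext => n; rewrite /series/= mulr_suml !mulr_sumr -!big_split.
  rewrite (_ : B = 1 * Phihat w + g * u * 0 + (w * g * u ^+ 2 / 2) * s2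
    + 38 * u ^+ 2 * L); last by rewrite mul1r mulr0 addr0.
  by repeat apply: cvgD; (apply: cvgMl || apply: cvgMr).
apply: (@le_trans _ _ B%:E).
  apply: esum_le_series bB => i; rewrite mulr_ge0 ?Phihat_ge0//=.
  have -> : heat rho (x - Num.sqrt h * a i) = Phihat (w + - (u * a i)).
    by rewrite /heat mulrBl mulrAC us.
  have := Phihat_taylor w (- (u * a i)); rewrite -/g sqrrN exprMn normrN normrM.
  rewrite (ger0_norm u0) => /(ler_wpM2l (p_ge0 i)) /le_trans; apply.
  by rewrite /b /truncated_var le_eqVlt; apply/orP; left; apply/eqP; field.
rewrite lee_fin.
have ts : 0 <= s2 * u ^+ 2 by rewrite mulr_ge0 ?sqr_ge0.
have -> : heat (rho + s2 * h) x = Phihat (w / Num.sqrt (1 + s2 * u ^+ 2)).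
  rewrite /heat /w -mulrA -invfM -sqrtrM ?ltW//;
      congr (Phihat (_ / Num.sqrt _)).
  by rewrite u2; field; rewrite gt_eqF.
have := Phihat_dilate w ts; rewrite -/g => D.
have u2le : u ^+ 2 <= h / rho0 by rewrite u2 ler_wpM2l// lef_pV2// posrE.
have t1 : (s2 * u ^+ 2) ^+ 2 <= (s2 * h / rho0) ^+ 2.
  by rewrite ler_sqr ?nnegrE// -?mulrA ?ler_wpM2l// mulr_ge0// divr_ge0// ltW.
have ule : u <= Num.sqrt (h / rho0) by rewrite ler_wsqrtr// -u2.
have L0 : 0 <= L.
  apply: limr_ge => //; apply: nearW => n; apply: sumr_ge0 => i _.
  exact: truncated_var_ge0.
have t2 : u ^+ 2 * L <= (h / rho0) * (e + C * Num.sqrt (h / rho0)).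
  rewrite ler_pM ?sqr_ge0//; apply: le_trans tle _.
  by rewrite lerD2l ler_wpM2l.
by rewrite /B; lra.
Qed.

End lindeberg.

(** * Sums over tuples *)

Section tuple_sums.
Context {R : realType}.
Local Open Scope ereal_scope.

Lemma le_esumZl (T : choiceType) (c : R) (f : T -> \bar R) :
  (0 <= c)%R -> (forall i, 0 <= f i) ->
  \esum_(i in [set: T]) (c%:E * f i) <= c%:E * \esum_(i in [set: T]) f i.
Proof.
move=> c0 f0; apply: ge_ereal_sup => _ [F [finF _] <-].
rewrite fsbig_finite//= -ge0_sume_distrr//; apply: lee_wpmul2l;
    first by rewrite lee_fin.
by apply: ereal_sup_ubound; exists F; [split|rewrite fsbig_finite].
Qed.

Lemma ge0_esumZl (T : choiceType) (c : R) (f : T -> \bar R) :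
  (0 <= c)%R -> (forall i, 0 <= f i) ->
  \esum_(i in [set: T]) (c%:E * f i) = c%:E * \esum_(i in [set: T]) f i.
Proof.
move=> c0 f0; apply/eqP; rewrite eq_le le_esumZl//=.
have [->|c_neq0] := eqVneq c 0%R.
  by rewrite mul0e; apply: esum_ge0 => i _; rewrite mul0e.
have c_gt0 : (0 < c)%R by rewrite lt_neqAle eq_sym c_neq0.
have ci0 : (0 <= c^-1)%R by rewrite invr_ge0.
have := @le_esumZl T c^-1 (fun i => c%:E * f i) ci0.
under eq_esum do rewrite muleA -EFinM mulVf// mul1e.
move=> /(_ (fun i => mule_ge0 _ (f0 i))) H.
rewrite -[leRHS]mul1e -(mulfV c_neq0) EFinM -muleA.
by apply: lee_wpmul2l; [rewrite lee_fin|apply: H; rewrite lee_fin].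
Qed.

Lemma esum_tupleS (T : choiceType) n (f : n.+1.-tuple T -> \bar R) :
  (forall k, 0 <= f k) ->
  \esum_(k in [set: n.+1.-tuple T]) f k =
  \esum_(i in [set: T]) \esum_(k in [set: n.-tuple T]) f [tuple of i :: k].
Proof.
move=> f0; rewrite esum_esum//.
rewrite (@reindex_esum _ _ _ ([set: T] `*`` fun=> [set: n.-tuple T]) _
  (fun k : T * n.-tuple T => [tuple of k.1 :: k.2]))//.
split=> //.
- move=> [i k] [j l] _ _ /= [-> kl]; congr (_, _); exact/val_inj.
- by move=> k _; exists (thead k, [tuple of behead k]) => //=;
    rewrite -tuple_eta.
Qed.

Lemma prod_tuple_cons (T : Type) n (q : T -> R) (i : T) (k : n.-tuple T) :
  (\prod_(l < n.+1) q (tnth [tuple of i :: k] l) =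
   q i * \prod_(l < n) q (tnth k l))%R.
Proof.
rewrite big_ord_recl tnth0; congr (_ * _)%R.
by apply: eq_bigr => l _; rewrite tnthS.
Qed.

Lemma sum_tuple_cons (T : Type) n (q : T -> R) (i : T) (k : n.-tuple T) :
  (\sum_(l < n.+1) q (tnth [tuple of i :: k] l) =
   q i + \sum_(l < n) q (tnth k l))%R.
Proof.
rewrite big_ord_recl tnth0; congr (_ + _)%R.
by apply: eq_bigr => l _; rewrite tnthS.
Qed.

Lemma esum_tuple0 (T : choiceType) (f : 0.-tuple T -> \bar R) :
  (forall k, 0 <= f k) -> \esum_(k in [set: 0.-tuple T]) f k = f [tuple].
Proof.
move=> f0; rewrite (_ : [set: _] = [set [tuple]]) ?esum_set1//.
by apply/seteqP; split=> // k _; rewrite /= tuple0.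
Qed.

Lemma esum_prod_tuple (T : choiceType) (q : T -> R) (S : R) n :
  (forall i, 0 <= q i)%R -> \esum_(i in [set: T]) (q i)%:E = S%:E ->
  \esum_(k in [set: n.-tuple T]) (\prod_(l < n) q (tnth k l))%:E = (S ^+ n)%:E.
Proof.
move=> q0 qS; elim: n => [|n IH].
  by rewrite esum_tuple0 ?big_ord0// => k; rewrite lee_fin prodr_ge0.
rewrite esum_tupleS; last by move=> k; rewrite lee_fin prodr_ge0.
under eq_esum => i _.
  under eq_esum do rewrite prod_tuple_cons EFinM.
  rewrite ge0_esumZl//; last by move=> k; rewrite lee_fin prodr_ge0.
  rewrite IH muleC; over.
have S0 : (0 <= S)%R by rewrite -lee_fin -qS esum_ge0// => i _; rewrite lee_fin.
rewrite ge0_esumZl ?exprn_ge0//.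
by rewrite qS -EFinM exprSr.
Qed.

End tuple_sums.

(** * An upper central limit theorem for discrete laws *)

Section step_error.
Context {R : realType}.
Variables (s2 v dl : R).
Hypotheses (v0 : 0 < v) (dl0 : 0 < dl).

(** The error of one replacement for the step h = 1/n at the initial variance
    v, as it comes out of [lindeberg_step]. *)
Definition step_error (e C : R) (n : nat) : R :=
  15 * (s2 * n%:R^-1 / v) ^+ 2 +
  38 * ((n%:R^-1 / v) * (e + C * Num.sqrt (n%:R^-1 / v))).

Lemma step_error_ge0 e C n : 0 <= e -> 0 <= C -> 0 <= step_error e C n.
Proof.
move=> e0 C0.
rewrite /step_error; have A1 := sqr_ge0 (s2 * n%:R^-1 / v).
have A2 : 0 <= n%:R^-1 / v by rewrite divr_ge0 ?invr_ge0// ltW.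
have A3 : 0 <= C * Num.sqrt (n%:R^-1 / v) by rewrite mulr_ge0.
by have := mulr_ge0 A2 (addr_ge0 e0 A3); lra.
Qed.

Lemma sqrtr_le (x c : R) : 0 <= c -> x <= c ^+ 2 -> Num.sqrt x <= c.
Proof. by move=> c0 xc; rewrite -(ger0_norm c0) -sqrtr_sqr ler_wsqrtr. Qed.

Lemma near_invn_le (K : R) : 0 < K -> \forall m \near \oo, m%:R^-1 <= K.
Proof.
move=> K0; near=> m; rewrite -[K]invrK.
have Km : K^-1 <= m%:R by near: m; exact: nbhs_infty_ger.
by rewrite lef_pV2// posrE ?invr_gt0//; apply: lt_le_trans Km; rewrite invr_gt0.
Unshelve. all: by end_near. Qed.

(** Among the three terms of n times the error, only the one with e does not
    tend to zero, and e is chosen small beforehand. *)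
Lemma step_error_small : exists e : R, 0 < e /\ forall C : R, 0 <= C ->
  \forall n \near \oo, n%:R * step_error e C n <= dl / 2.
Proof.
(* 304 = 38 * 8: the term with e then contributes exactly dl / 8. *)
exists (dl * v / 304); split; first by have := mulr_gt0 dl0 v0; lra.
move=> C C0.
  pose k1 : R := 15 * (s2 / v) ^+ 2; pose k2 : R := 38 * (C / v).
  have k10 : 0 <= k1 by rewrite /k1; have := sqr_ge0 (s2 / v); lra.
  have k20 : 0 <= k2 by rewrite /k2; have := divr_ge0 C0 (ltW v0); lra.
  have K1 : 0 < dl / 8 / (k1 + 1) by rewrite divr_gt0 ?divr_gt0// ltr_wpDl.
  have K2 : 0 < dl / 8 / (k2 + 1) by rewrite divr_gt0 ?divr_gt0// ltr_wpDl.
  near=> n.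
  have n0 : n%:R != 0 :> R by rewrite pnatr_eq0 -lt0n; near: n; exists 1%N.
  have i1 : n%:R^-1 <= dl / 8 / (k1 + 1).
    by near: n; exact: near_invn_le.
  have i2 : n%:R^-1 <= v * (dl / 8 / (k2 + 1)) ^+ 2.
    by near: n; apply: near_invn_le; rewrite mulr_gt0 ?exprn_gt0.
  have s_le : Num.sqrt (n%:R^-1 / v) <= dl / 8 / (k2 + 1).
    by apply: sqrtr_le; [exact: ltW|rewrite ler_pdivrMr// mulrC].
  have -> : n%:R * step_error (dl * v / 304) C n =
      k1 * n%:R^-1 + dl / 8 + k2 * Num.sqrt (n%:R^-1 / v).
    rewrite /step_error /k1 /k2; set q := Num.sqrt _; field.
    by rewrite n0 gt_eqF.
  have a1 : k1 * n%:R^-1 <= dl / 8.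
    move: i1; rewrite ler_pdivlMr ?ltr_wpDl//.
    by have : 0 <= n%:R^-1 :> R by []; nra.
  have a2 : k2 * Num.sqrt (n%:R^-1 / v) <= dl / 8.
    move: s_le; rewrite ler_pdivlMr ?ltr_wpDl//.
    by have := sqrtr_ge0 (n%:R^-1 / v); nra.
  have := dl0; move: a1 a2; set A := k1 / _; set B := k2 * _; lra.
Unshelve. all: by end_near. Qed.

End step_error.

Section clt.
Context {R : realType}.
Variables (p a : nat -> R) (s2 : R).
Hypothesis p_ge0 : forall i, 0 <= p i.
Hypothesis p_sum : series p @ \oo --> (1 : R).
Hypothesis a_mean : series (fun i => p i * a i) @ \oo --> (0 : R).
Hypothesis a_var : series (fun i => p i * a i ^+ 2) @ \oo --> s2.

Lemma weighted_var_ge0 : 0 <= s2.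
Proof.
rewrite -(cvg_lim _ a_var)//; apply: limr_ge; first by apply/cvg_ex; exists s2.
by apply: nearW => n; apply: sumr_ge0 => i _; rewrite mulr_ge0 ?sqr_ge0.
Qed.

Lemma esum_weights : (\esum_(i in [set: nat]) (p i)%:E = 1)%E.
Proof.
rewrite -nneseries_esumT; last by move=> i; rewrite lee_fin.
apply/cvg_lim => //; rewrite (_ : (fun n => _) = EFin \o series p).
  by apply: cvg_EFin; [exact: nearW|exact: p_sum].
by apply/funext => n; rewrite /= sumEFin.
Qed.

(** The n replacements add up: conditioning on the first summand, the sum over
    the others is bounded by induction, uniformly in the starting point. *)
Lemma lindeberg_iter (rho0 h C e r : R) n x :
  0 < rho0 -> 0 <= h -> 0 <= C ->
  (forall u, 0 <= u -> cvgn (series (truncated_var p a u)) /\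
                      limn (series (truncated_var p a u)) <= e + C * u) ->
  r = 15 * (s2 * h / rho0) ^+ 2 +
      38 * ((h / rho0) * (e + C * Num.sqrt (h / rho0))) -> 0 <= r ->
  (\esum_(k in [set: n.-tuple nat]) ((\prod_(l < n) p (tnth k l)) *
       heat rho0 (x - Num.sqrt h * \sum_(l < n) a (tnth k l)))%:E <=
   (heat (rho0 + s2 * h * n%:R) x + n%:R * r)%:E)%E.
Proof.
move=> rho00 h0 C0 HC rE r0; elim: n x => [|n IH] x.
  rewrite esum_tuple0; last by move=> k; rewrite lee_fin mulr_ge0 ?prodr_ge0
      ?Phihat_ge0.
  by rewrite !big_ord0 mul1r !mulr0 mul0r subr0 !addr0.
rewrite esum_tupleS; last by move=> k; rewrite lee_fin mulr_ge0 ?prodr_ge0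
    ?Phihat_ge0.
under eq_esum => i _.
  under eq_esum => k _.
    rewrite prod_tuple_cons sum_tuple_cons mulrDr opprD addrA -mulrA EFinM.
    over.
  rewrite ge0_esumZl//; last first.
    by move=> k; rewrite lee_fin mulr_ge0 ?prodr_ge0 ?Phihat_ge0.
  over.
apply: (@le_trans _ _ (\esum_(i in [set: nat])
   ((p i * heat (rho0 + s2 * h * n%:R) (x - Num.sqrt h * a i))%:E
     + (n%:R * r)%:E * (p i)%:E))%E).
  apply: le_esum => i _; apply: (@le_trans _ _ ((p i)%:E *
    (heat (rho0 + s2 * h * n%:R) (x - Num.sqrt h * a i) + n%:R * r)%:E)%E).
    by apply: lee_wpmul2l; [rewrite lee_fin|exact: IH].
  by rewrite -!EFinM -EFinD mulrDr [p i * (_ * r)]mulrC.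
rewrite esumD; last 2 first.
- by move=> i _; rewrite lee_fin mulr_ge0 ?Phihat_ge0.
- by move=> i _; rewrite -EFinM lee_fin mulr_ge0 ?mulr_ge0.
rewrite ge0_esumZl ?mulr_ge0//.
rewrite esum_weights mule1.
have rhole : rho0 <= rho0 + s2 * h * n%:R
    by rewrite lerDl !mulr_ge0 ?weighted_var_ge0.
have := lindeberg_step p_ge0 p_sum a_mean a_var x rho00 rhole h0 C0 HC.
rewrite -addrA -rE => /(leeD2r (n%:R * r)%:E) /le_trans; apply.
have -> : rho0 + s2 * h * n.+1%:R = rho0 + s2 * h * n%:R + s2 * h.
  by rewrite -natr1; ring.
by rewrite -EFinD lee_fin -natr1; lra.
Qed.

(** The indicator of the half-line beyond y is at most the smoothed step
    heat v (z - .) divided by eta, where z < y, the scale v is small and eta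
    is close to 1; the mean of the smoothed step is close to its Gaussian
    value by [lindeberg_iter]. *)
Lemma clt_tail (y e2 : R) : 0 < s2 -> Phihat (y / Num.sqrt s2) < e2 ->
  \forall n \near \oo, (\esum_(k in [set k : n.-tuple nat |
      (y * Num.sqrt n%:R < \sum_(l < n) a (tnth k l))%R])
    (\prod_(l < n) p (tnth k l))%:E <= e2%:E)%E.
Proof.
move=> s20 ye2.
have e2_gt0 : 0 < e2 by apply: le_lt_trans ye2; exact: Phihat_ge0.
have [z zy ze2] : exists2 z : R, z < y & Phihat (z / Num.sqrt s2) < e2.
  have : {for y, continuous (fun z : R => Phihat (z / Num.sqrt s2))}.
    apply: continuous_comp; last exact: continuous_Phihat.
    by apply: cvgM; [exact: cvg_id|exact: cvg_cst].
  move=> /cvgr_lt /(_ _ ye2) [d /= d0 H]; exists (y - d / 2); first lra.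
  by apply: H; rewrite /= opprB addrCA subrr addr0 gtr0_norm; lra.
(* The room left by the strict inequality is shared between eta, which pays for
   the smoothing of the indicator, and dl, which pays for the variance added by
   the smoothing and for the replacement error. *)
have [dl [eta [dl0 eta0 etaE]]] : exists (dl eta : R), [/\ 0 < dl, 0 < eta &
    Phihat (z / Num.sqrt s2) + dl <= e2 * eta /\ eta < 1].
  pose P := Phihat (z / Num.sqrt s2); have P0 : 0 <= P by exact: Phihat_ge0.
  exists ((e2 - P) / 2), ((e2 + P) / 2 / e2); split.
  - by rewrite /P; lra.
  - by rewrite divr_gt0//; lra.
  - rewrite [e2 * _]mulrC divfK ?gt_eqF//; split; first by rewrite -/P; lra.
    by rewrite ltr_pdivrMr// /P; lra.
have [/= ze2' eta1] := etaE.
have [v v0 [Hv1 Hv2]] : exists2 v : R, 0 < v &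
    Phihat (z / Num.sqrt (v + s2)) <= Phihat (z / Num.sqrt s2) + dl / 2 /\
    eta <= heat v (z - y).
  have [A HA] : exists A, forall x : R, x <= A -> eta <= Phihat x.
    have /cvgr_gt /(_ _ eta1) [A [_ HA]] := @cvg_PhihatNy R.
    by exists (A - 1) => x xA; apply/ltW/HA; lra.
  have : Phihat (z / Num.sqrt (v + s2)) @[v --> (0 : R)^'+] -->
      Phihat (z / Num.sqrt (0 + s2)).
    apply: cvg_at_right_filter.
    apply: (@continuous_comp _ _ _ (fun v : R => z / Num.sqrt (v + s2)) (@Phihat
        R));
      last exact: continuous_Phihat.
    apply: cvgM; first exact: cvg_cst.
    apply: cvgV; first by rewrite add0r gt_eqF// sqrtr_gt0.
    apply: (@continuous_comp _ _ _ (fun v : R => v + s2) Num.sqrt);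
      last exact: sqrt_continuous.
    by apply: cvgD; [exact: cvg_id|exact: cvg_cst].
  rewrite add0r => /cvgr_le /(_ (Phihat (z / Num.sqrt s2) + dl / 2)) H.
  have {}H := H (ltac:(lra)).
  have A0 : 0 < `|A| + 1 by rewrite ltr_wpDl.
  have yzA : 0 < (y - z) / (`|A| + 1) by rewrite divr_gt0// subr_gt0.
  near (0 : R)^'+ => v; exists v; first by near: v; exact: nbhs_right_gt.
  have v0 : 0 < v by near: v; exact: nbhs_right_gt.
  split; first by near: v; exact: H.
  have vle : v < ((y - z) / (`|A| + 1)) ^+ 2.
    by near: v; apply: nbhs_right_lt; rewrite exprn_gt0//.
  apply: HA; rewrite ler_pdivrMr ?sqrtr_gt0//.
  have : Num.sqrt v <= (y - z) / (`|A| + 1).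
    by apply: sqrtr_le; exact: ltW.
  rewrite ler_pdivlMr// => sv.
  have : - `|A| <= A by rewrite lerNl -normrN ler_norm.
  by have := sqrtr_ge0 v; nra.
have [e [e0 Herr]] := step_error_small s2 v0 dl0.
have [C C0 HC] := truncated_var_small p_ge0 a_var e0.
pose r n := step_error s2 v e C n.
have r0 n : 0 <= r n by apply: step_error_ge0 => //; exact: ltW.
have nr : \forall n \near \oo, n%:R * r n <= dl / 2 by exact: Herr C0.
near=> n.
have n0 : (0 < n)%N by near: n; exists 1%N.
have sn0 : 0 < Num.sqrt (n%:R : R) by rewrite sqrtr_gt0 ltr0n.
have snn : Num.sqrt (n%:R : R)^-1 = (Num.sqrt n%:R)^-1 by rewrite sqrtrV.
have := @lindeberg_iter v n%:R^-1 C _ (r n) n z v0 _ C0 HC erefl (r0 n).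
rewrite invr_ge0 => /(_ (ler0n _ _)).
rewrite -mulrA mulVf ?pnatr_eq0 -?lt0n// mulr1 => main.
have {}main := le_trans main (_ : (_ <= (e2 * eta)%:E)%E).
rewrite lee_fin in main.
have nrn : n%:R * r n <= dl / 2 by near: n; exact: nr.
have {}main := main (le_trans (lerD Hv1 nrn) _).
rewrite -addrA -splitr in main; have {}main := main ze2'.
apply: (@le_trans _ _ (\esum_(k in [set: n.-tuple nat]) ((eta^-1)%:E *
   (\prod_(l < n) p (tnth k l) * heat v (z - Num.sqrt n%:R^-1 *
      \sum_(l < n) a (tnth k l)))%:E))%E).
  rewrite [leLHS]esum_mkcond. apply: le_esum => k _; case: ifPn; last first.
    by rewrite mule_ge0// lee_fin ?invr_ge0 ?(ltW eta0)// mulr_ge0 ?prodr_ge0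
      ?Phihat_ge0.
  rewrite inE /= -EFinM lee_fin => yk.
  rewrite mulrCA ler_peMr ?prodr_ge0// ler_pdivlMl// mulr1.
  apply: le_trans Hv2 _; apply: Phihat_le.
  rewrite ler_pM2r ?invr_gt0 ?sqrtr_gt0// lerD2l lerN2 snn.
  by rewrite ler_pdivlMl// mulrC ltW.
rewrite ge0_esumZl ?invr_ge0 ?(ltW eta0)//; last first.
  by move=> k; rewrite lee_fin mulr_ge0 ?prodr_ge0 ?Phihat_ge0.
have -> : e2%:E = ((eta^-1)%:E * (e2 * eta)%:E)%E.
  by rewrite -EFinM mulrC mulfK ?gt_eqF.
by apply: lee_wpmul2l; rewrite ?lee_fin ?invr_ge0 ?(ltW eta0).
Unshelve. all: by end_near. Qed.

End clt.

(** * Counting the large eigenvalues *)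

Section index_set.
Context {R : realType}.
Variable lam : nat -> R.
Hypothesis lam_ge0 : forall i, 0 <= lam i.
Hypothesis cvg_Lambda : cvgn (series (fun i => lam i ^+ 2)).
Hypothesis Lambda_gt0 : 0 < Lambda lam.
Hypothesis cvg_M2 : cvgn (series (M2_terms lam)).
Hypothesis sigma2_gt0 : 0 < sigma2 lam.

Local Notation L := (Lambda lam).
Let p i := lam i ^+ 2 / L.
Let a i := - ln (lam i) - M lam.

Let p_ge0 i : 0 <= p i. Proof. by rewrite divr_ge0 ?sqr_ge0// ltW. Qed.

Let p_sum : series p @ \oo --> (1 : R).
Proof.
rewrite (_ : series p = fun n => series (fun i => lam i ^+ 2) n * L^-1).
  rewrite -[X in _ --> X](divff (lt0r_neq0 Lambda_gt0)).
  by apply: cvgMl; exact: cvg_Lambda.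
by apply/funext => n; rewrite /series/= mulr_suml.
Qed.

Let cvg_M : series (fun i => ln (lam i) * (lam i ^+ 2 / L)) @ \oo --> - M lam.
Proof.
rewrite /M opprK; apply/cvg_ex; eexists => /=; apply: normed_cvg.
apply: (series_le_cvg (v_ := fun i => M2_terms lam i / L + p i)) => [i|i|i|].
- exact: normr_ge0.
- by rewrite addr_ge0// divr_ge0 ?mulr_ge0 ?sqr_ge0// ltW.
- rewrite /= normrM (ger0_norm (p_ge0 i)) /M2_terms -mulrA -/(p i).
  move: (p_ge0 i) `|_| => + b; move: (p i) => P P0.
  have : 0 <= (b ^+ 2 + 1 - b) * P.
    by rewrite mulr_ge0//; have := sqr_ge0 (b - 1); have := sqr_ge0 b; lra.
  by lra.
- have -> : series (fun i => M2_terms lam i / L + p i) =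
     (fun n => series (M2_terms lam) n * L^-1) \+ series p.
    by apply/funext => n; rewrite /series/= mulr_suml -big_split.
  apply: is_cvgD; last by apply/cvg_ex; exists 1.
  by apply: is_cvgMl.
Qed.

Let a_mean : series (fun i => p i * a i) @ \oo --> (0 : R).
Proof.
rewrite (_ : series _ = fun n => - series (fun i => ln (lam i) * p i) n
   + - (M lam * series p n)).
  rewrite (_ : 0 = - - M lam + - (M lam * 1));
      last by rewrite mulr1 opprK subrr.
  by apply: cvgD; apply: cvgN => //; apply: cvgMr.
apply/funext => n; rewrite /series/= mulr_sumr -!sumrN -big_split/=.
by apply: eq_bigr => i _; rewrite /a; ring.
Qed.

Let a_var : series (fun i => p i * a i ^+ 2) @ \oo --> sigma2 lam.
Proof.
rewrite (_ : series _ = fun n => series (M2_terms lam) n * L^-1 +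
   (2 * M lam * series (fun i => ln (lam i) * p i) n
   + M lam ^+ 2 * series p n)).
  rewrite (_ : sigma2 lam = M2 lam * L^-1 +
    (2 * M lam * (- M lam) + M lam ^+ 2 * 1)); last by rewrite /sigma2; ring.
  apply: cvgD; first by apply: cvgMl; exact: cvg_M2.
  by apply: cvgD; apply: cvgMr.
apply/funext => n; rewrite /series/= mulr_suml !mulr_sumr -!big_split/=.
apply: eq_bigr => i _; rewrite /a /M2_terms real_normK ?num_real// /p.
by ring.
Qed.

Lemma esum_eigenvalues d : (\esum_(k in [set: d.-tuple nat])
  ((\prod_(l < d) lam (tnth k l)) ^+ 2)%:E = (L ^+ d)%:E)%E.
Proof.
under eq_esum do rewrite -prodrXl.
apply: (@esum_prod_tuple _ _ (fun i => lam i ^+ 2)) => [i|];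
    first exact: sqr_ge0.
rewrite -nneseries_esumT; last by move=> i; rewrite lee_fin sqr_ge0.
apply/cvg_lim => //; rewrite (_ : (fun n => _) =
    EFin \o series (fun i => lam i ^+ 2)).
  by apply: cvg_EFin; [exact: nearW|exact: cvg_Lambda].
by apply/funext => n; rewrite /= sumEFin.
Qed.

(** The bound is Markov's inequality for the counting measure. *)
Lemma card_le_of_large (d : nat) (F : {fset d.-tuple nat}) (th : R) : 0 < th ->
  (forall k, k \in F -> th <= \prod_(l < d) lam (tnth k l)) ->
  #|` F|%:R <= L ^+ d / th ^+ 2.
Proof.
move=> th0 thF; rewrite ler_pdivlMr ?exprn_gt0// -lee_fin -(esum_eigenvalues d).
apply: esum_ge; exists [set` F]; first by split.
rewrite fsbig_finite//= set_fsetK sumEFin lee_fin.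
have -> : #|` F|%:R * th ^+ 2 = \sum_(k <- F) th ^+ 2.
  by rewrite big_const_seq count_predT iter_addr addr0 mulr_natl.
rewrite big_seq [leRHS]big_seq; apply: ler_sum => k kF.
have thk := thF k kF; have th1 := ltW th0.
by rewrite ler_sqr// nnegrE (le_trans th1).
Qed.

(** The set F consists of the indices with - sum_l ln lam(k_l) at most
    d M + y sqrt d.  Its complement is the upper tail of a sum of d
    independent variables, except for indices of eigenvalue zero, which do
    not contribute to the sum. *)
Lemma tail_index_set (y e2 : R) : Phihat (y / sigma lam) < e2 ->
  \forall d \near \oo, exists F : {fset d.-tuple nat},
    #|` F|%:R <= expR (d%:R * ln (Lambda_star lam) + 2 * y * Num.sqrt d%:R) /\
    (\esum_(k in ~` [set` F]) ((\prod_(l < d) lam (tnth k l)) ^+ 2)%:E <=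
      (e2 * L ^+ d)%:E)%E.
Proof.
move=> ye2; have := clt_tail p_ge0 p_sum a_mean a_var sigma2_gt0 ye2.
apply: filterS => d tail.
pose th := expR (- (d%:R * M lam + y * Num.sqrt d%:R)).
pose A := [set k : d.-tuple nat | th <= \prod_(l < d) lam (tnth k l)].
have th0 : 0 < th by exact: expR_gt0.
have finA : finite_set A.
  apply: contrapT => /infinite_set_fset.
  move=> /(_ (Num.truncn (L ^+ d / th ^+ 2)).+1) [F FA].
  have := card_le_of_large th0 (fun k kF => FA k kF).
  have := truncnS_gt (L ^+ d / th ^+ 2) => h1 h2 h3.
  have : ((Num.truncn (L ^+ d / th ^+ 2)).+1%:R : R) <= #|` F|%:R
      by rewrite ler_nat.
  lra.
exists (fset_set A); split.
  apply: (le_trans (card_le_of_large th0 _)).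
    by move=> k; rewrite in_fset_set// inE.
  have -> : L ^+ d = expR (d%:R * ln L) by rewrite expRM_natl lnK ?posrE.
  have -> : th ^+ 2 = expR (2 * - (d%:R * M lam + y * Num.sqrt d%:R)).
    by rewrite (expRM_natl 2).
  rewrite -expRN -expRD ler_expR /Lambda_star lnM ?posrE ?expR_gt0// expRK.
  by rewrite le_eqVlt; apply/orP; left; apply/eqP; ring.
rewrite fset_setK//.
apply: (@le_trans _ _ ((L ^+ d)%:E * (\esum_(k in [set k : d.-tuple nat |
      (y * Num.sqrt d%:R < \sum_(l < d) a (tnth k l))%R])
    (\prod_(l < d) p (tnth k l))%:E))%E); last first.
  rewrite [e2 * _]mulrC EFinM; apply: lee_wpmul2l; last exact: tail.
  by rewrite lee_fin exprn_ge0// (ltW Lambda_gt0).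
rewrite [X in (_ * X)%E]esum_mkcond -ge0_esumZl ?exprn_ge0 ?(ltW Lambda_gt0)//;
    last first.
  by move=> k; case: ifP => // _; rewrite lee_fin prodr_ge0.
rewrite [leLHS]esum_mkcond; apply: le_esum => k _.
have prodp : \prod_(l < d) p (tnth k l) = (\prod_(l <
    d) lam (tnth k l)) ^+ 2 / L ^+ d.
  by rewrite /p big_split/= prodrXl prodr_const card_ord exprVn.
case: ifPn; last first.
  by move=> _; case: ifPn => _; rewrite ?mule0// mule_ge0// lee_fin ?exprn_ge0
    ?(ltW Lambda_gt0)// prodr_ge0.
rewrite inE /= => /negP; rewrite -ltNge => kth.
have [lam0|lam_neq0] := eqVneq (\prod_(l < d) lam (tnth k l)) 0.
  rewrite lam0 expr0n/=; case: ifPn => _;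
      rewrite ?mule0// mule_ge0// lee_fin ?exprn_ge0 ?(ltW Lambda_gt0)//
          prodr_ge0//.
rewrite ifT; last first.
  rewrite inE /=.
  have lamp l : 0 < lam (tnth k l).
    rewrite lt_neqAle lam_ge0 andbT eq_sym; apply: contra_neq lam_neq0 => l0.
    by rewrite (bigD1 l)//= l0 mul0r.
  have -> : \sum_(l < d) a (tnth k l) = - ln (\prod_(l <
      d) lam (tnth k l)) - d%:R * M lam.
    have -> : \prod_(l < d) lam (tnth k l) = expR (\sum_(l <
        d) ln (lam (tnth k l))).
      by rewrite expR_sum; apply: eq_bigr => l _; rewrite lnK// posrE.
    rewrite expRK /a sumrB sumrN sumr_const card_ord mulr_natl//.
  have prod_gt0 : 0 < \prod_(l < d) lam (tnth k l).
    by apply: prodr_gt0 => l _; exact: lamp.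
  rewrite ltrBrDr ltrNr -[X in _ < X]expRK ltr_ln ?posrE ?expR_gt0//.
  by rewrite addrC.
rewrite -EFinM lee_fin prodp mulrC divfK// gt_eqF// exprn_gt0//.
Qed.

End index_set.

Section sampling_sizes.
Context {R : realType}.
Variable lam : nat -> R.
Hypothesis lam_ge0 : forall i, 0 <= lam i.
Hypothesis cvg_Lambda : cvgn (series (fun i => lam i ^+ 2)).
Hypothesis Lambda_gt0 : 0 < Lambda lam.

Local Notation L := (Lambda lam).

Definition small_tail (e2 : R) d (F : {fset d.-tuple nat}) : Prop :=
  (\esum_(k in ~` [set` F]) ((\prod_(l < d) lam (tnth k l)) ^+ 2)%:E <=
      (e2 * L ^+ d)%:E)%E.

Lemma exists_small_tail (e2 : R) d : 0 < e2 -> exists F, @small_tail e2 d F.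
Proof.
move=> e20; have Ld : 0 < L ^+ d by rewrite exprn_gt0.
have T := esum_eigenvalues cvg_Lambda d.
have /ereal_sup_gt[_ [X [finX _] <-]] :
    (((1 - e2) * L ^+ d)%:E < \esum_(k in [set: d.-tuple nat])
      ((\prod_(l < d) lam (tnth k l)) ^+ 2)%:E)%E.
  by rewrite T lte_fin; nra.
move=> Xgt; exists (fset_set X); rewrite /small_tail fset_setK//.
have nn (k : d.-tuple nat) : (0 <= ((\prod_(l < d) lam (tnth k l)) ^+ 2)%:E)%E.
  by rewrite lee_fin sqr_ge0.
have := esumID X [set: d.-tuple nat] (fun k => ((\prod_(l <
    d) lam (tnth k l)) ^+ 2)%:E)
  (fun k _ => nn k).
rewrite T !setTI esum_fset//.
move: Xgt; rewrite fsbig_finite//= sumEFin lte_fin.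
set S := \sum_(_ <- _) _; move=> SL.
have : (0 <= \esum_(k in ~` X) ((\prod_(l < d) lam (tnth k l)) ^+ 2)%:E)%E.
  by apply: esum_ge0.
case: (\esum_(k in ~` X) _) => [r r0 [E]| _ //|//].
by rewrite lee_fin; lra.
Qed.

Lemma small_tail_gt0 (e2 : R) d (F : {fset d.-tuple nat}) : e2 < 1 ->
  small_tail e2 F -> (0 < #|` F|)%N.
Proof.
move=> e21; rewrite /small_tail cardfs_gt0; apply: contraPN => /eqP ->.
have -> : [set` fset0] = set0 :> set (d.-tuple nat).
  by apply/seteqP; split => k //=; rewrite inE.
rewrite setC0 esum_eigenvalues// lee_fin; apply/negP; rewrite -ltNge.
by rewrite gtr_pMl// exprn_gt0.
Qed.

Lemma minimal_small_tail (e2 : R) d : 0 < e2 -> exists F,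
  @small_tail e2 d F /\ forall F', @small_tail e2 d F' -> (#|` F| <= #|` F'|)%N.
Proof.
move=> e20; pose Q n := `[< exists F, @small_tail e2 d F /\ #|` F| = n >].
have exQ : exists n, Q n.
  have [F FT] := exists_small_tail d e20.
  by exists #|` F|; apply/asboolP; exists F.
have [n /asboolP[F [FT <-]] Hmin] := ex_minnP exQ.
by exists F; split=> // F' F'T; apply: Hmin; apply/asboolP; exists F'.
Qed.

Hypothesis cvg_M2 : cvgn (series (M2_terms lam)).
Hypothesis sigma2_gt0 : 0 < sigma2 lam.

(** The lower bound on m holds by construction.  For the upper bound, let E
    be the exponent d ln Lambda_star + 2 y sqrt d for some y > q.  Since F is
    nonempty and has at most exp E elements, E is nonnegative, so that the
    rounding costs only a constant factor. *)
Lemma sampling_sizes (eps q : R) : 0 < eps < 1 ->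
  Phihat (q / sigma lam) = eps ^+ 2 ->
  exists (F : forall d, {fset d.-tuple nat}) (m : nat -> nat),
   [/\ forall d, small_tail (eps ^+ 2) (F d),
       forall d, (0 < #|` F d|)%N,
       forall d, (0 < m d)%N,
       forall d, #|` F d|%:R <= eps ^+ 2 * (m d)%:R
     & (fun d : nat =>
           (ln ((m d)%:R : R) - d%:R * ln (Lambda_star lam)) / Num.sqrt d%:R)
          @ \oo --> 2 * q].
Proof.
move=> /andP[eps0 eps1] hq.
have e20 : 0 < eps ^+ 2 by rewrite exprn_gt0.
have e21 : eps ^+ 2 < 1 by rewrite expr_lt1// ltW.
have sg0 : 0 < sigma lam by rewrite sqrtr_gt0.
pose F d := sval (cid (minimal_small_tail d e20)).
have FT d : small_tail (eps ^+ 2) (F d) by rewrite /F; case: cid => ? [].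
have Fmin d (F' : {fset d.-tuple nat}) : small_tail (eps ^+ 2) F' -> (#|` F d|
    <= #|` F'|)%N.
  rewrite /F; case: cid => G [GT Gmin] /=; exact: Gmin.
have F_gt0 d : (0 < #|` F d|)%N by exact: small_tail_gt0 (FT d).
pose W := ln (Lambda_star lam).
pose E y d := d%:R * W + 2 * y * Num.sqrt d%:R : R.
pose m1 d := (Num.truncn (#|` F d|%:R / eps ^+ 2 : R)).+1.
pose m2 d := (Num.truncn (expR (E q d))).+1.
pose m d := maxn (m1 d) (m2 d).
have m1_gt d : #|` F d|%:R / eps ^+ 2 < (m1 d)%:R :> R by exact: truncnS_gt.
have m2_gt d : expR (E q d) < (m2 d)%:R :> R by exact: truncnS_gt.
have truncS_le (x : R) : 0 <= x -> (Num.truncn x).+1%:R <= x + 1.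
  by move=> x0; rewrite -natr1 lerD2r truncn_le.
exists F, m; split=> // [d|d|].
- by rewrite leq_max /m1.
- rewrite mulrC -ler_pdivrMr// (le_trans (ltW (m1_gt d)))// ler_nat.
  exact: leq_maxl.
have m_gt0 d : 0 < (m d)%:R :> R by rewrite ltr0n leq_max /m1.
have mlow d : E q d <= ln (m d)%:R.
  rewrite -[leLHS]expRK ler_ln ?posrE ?expR_gt0//.
  by rewrite (le_trans (ltW (m2_gt d)))// ler_nat leq_maxr.
pose K := ln ((eps ^+ 2)^-1 + 1).
have mup (y : R) : q < y -> \forall d \near \oo, ln (m d)%:R <= K + E y d.
  move=> qy.
  have : Phihat (y / sigma lam) < eps ^+ 2.
    by rewrite -hq; apply: Phihat_lt; rewrite ltr_pM2r// invr_gt0.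
  move=> /(tail_index_set lam_ge0 cvg_Lambda Lambda_gt0 cvg_M2 sigma2_gt0).
  apply: filterS => d [F' [F'card F'T]].
  have Fcard : #|` F d|%:R <= expR (E y d).
    by apply: le_trans F'card; rewrite ler_nat; exact: Fmin.
  have E1 : 1 <= expR (E y d).
    by apply: le_trans Fcard; rewrite ler1n.
  have ie1 : 1 <= (eps ^+ 2)^-1 by rewrite invf_ge1// ltW.
  have ei0 : 0 < (eps ^+ 2)^-1 by rewrite invr_gt0.
  rewrite -[E y d]expRK -lnM ?posrE ?expR_gt0//; last by lra.
  rewrite ler_ln ?posrE//; last by rewrite mulr_gt0 ?expR_gt0//; lra.
  have qE : expR (E q d) <= expR (E y d).
    by rewrite ler_expR lerD2l ler_wpM2r ?sqrtr_ge0// ler_pM2l// ltW.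
  rewrite /m /maxn; case: ifP => _.
    apply: (le_trans (truncS_le _ (expR_ge0 _))).
    by nra.
  have fn0 : 0 <= #|` F d|%:R / eps ^+ 2 :> R by rewrite divr_ge0// ltW.
  apply: (le_trans (truncS_le _ fn0)).
  have : #|` F d|%:R / eps ^+ 2 <= expR (E y d) / eps ^+ 2 :> R
      by rewrite ler_pM2r.
  by lra.
apply/cvgrPdist_le => dl dl0.
have qy : q < q + dl / 4 by lra.
near=> d.
have d0 : (0 < d)%N by near: d; exists 1%N.
have sd0 : 0 < Num.sqrt (d%:R : R) by rewrite sqrtr_gt0 ltr0n.
have up : ln (m d)%:R <= K + E (q + dl / 4) d by near: d; exact: mup.
have low := mlow d.
have Kd : K <= dl / 2 * Num.sqrt d%:R.
  have : (2 * `|K| / dl) ^+ 2 <= d%:R by near: d; exact: nbhs_infty_ger.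
  move=> /ler_wsqrtr; rewrite sqrtr_sqr => H.
  have := le_trans (ler_norm _) H; rewrite ler_pdivrMr// => {}H.
  have := ler_norm K; lra.
rewrite distrC -[X in _ - X](mulfK (lt0r_neq0 sd0)) -mulrBl normrM.
rewrite normrV ?unitfE ?gt_eqF// (gtr0_norm sd0) ler_pdivrMr//.
move: low up Kd; rewrite /E -/W; move: (ln _) (Num.sqrt _) (_ * W) => u v w.
by rewrite ler_norml; lra.
Unshelve. all: by end_near. Qed.

End sampling_sizes.

(** * Square-integrable functions and orthonormal systems *)

Section square_integrable.
Context d (T : measurableType d) (R : realType) (mu : {measure set T -> \bar
    R}).
Implicit Types f g : T -> R.

(** The elementary form of membership in L_2 (see [sq_integrable_Lfun]),
    convenient for algebra under the integral sign. *)
Definition sq_integrable f : Prop :=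
  measurable_fun setT f /\ mu.-integrable setT (EFin \o (fun x => f x ^+ 2)).

Lemma sq_integrableP f : measurable_fun setT f ->
  (\int[mu]_x (f x ^+ 2)%:E < +oo)%E -> sq_integrable f.
Proof.
move=> mf foo; split=> //; apply/integrableP; split.
  by apply/measurable_EFinP; exact: measurable_funX.
by under eq_integral do rewrite /= ger0_norm ?sqr_ge0//.
Qed.

Lemma sq_integrable_Lfun f : sq_integrable f <-> f \in Lfun mu 2%:E.
Proof.
split=> [[mf fi]|fL]; last first.
  split; last exact: Lfun2_integrable_sqr.
  by move: fL; rewrite inE => /andP[/[!inE]/=].
rewrite inE; apply/andP; split; rewrite inE//=.
rewrite /finite_norm unlock/=.
apply: poweR_lty; move/integrableP: fi => [_]; apply: le_lt_trans.
rewrite le_eqVlt; apply/orP; left; apply/eqP; apply: eq_integral => x _ /=.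
by rewrite normrX powR_mulrn.
Qed.

Lemma sq_integrableM f g : sq_integrable f -> sq_integrable g ->
  mu.-integrable setT (EFin \o (fun x => f x * g x)).
Proof.
move=> [mf fi] [mg gi].
apply: (le_integrable measurableT _ _ (integrableD measurableT fi gi)).
  by apply/measurable_EFinP; exact: measurable_funM.
move=> x _ /=; rewrite lee_fin [leRHS]ger0_norm ?addr_ge0 ?sqr_ge0//.
rewrite normrM -[f x ^+ 2]real_normK ?num_real// -[g x ^+ 2]real_normK
    ?num_real//.
by have := sqr_ge0 (`|f x| - `|g x|); have := sqr_ge0 (`|f x| + `|g x|); nra.
Qed.

Lemma sq_integrable0 : sq_integrable (cst 0).
Proof.
split=> //; rewrite (_ : EFin \o _ = cst 0%E); first exact: integrable0.
by apply/funext => x /=; rewrite expr0n.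
Qed.

Lemma sq_integrableZ f (c : R) : sq_integrable f -> sq_integrable (fun x => c *
    f x).
Proof.
move=> [mf fi]; split; first by apply: measurable_funM.
rewrite (_ : EFin \o _ = fun x => ((c ^+ 2)%:E * (f x ^+ 2)%:E)%E).
  exact: (integrableZl measurableT (c ^+ 2) fi).
by apply/funext => x /=; rewrite -EFinM exprMn.
Qed.

Lemma sq_integrableD f g : sq_integrable f -> sq_integrable g ->
  sq_integrable (fun x => f x + g x).
Proof.
move=> lf lg; have [[mf fi] [mg gi]] := (lf, lg).
split; first exact: measurable_funD.
have fg := sq_integrableM lf lg.
rewrite (_ : EFin \o _ = ((EFin \o (fun x => (f x ^+ 2)%R)) \+
   ((EFin \o (fun x => (g x ^+ 2)%R)) \+ (fun x => (2%:E * (f x * g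
       x)%:E)%E)))%E).
  apply: integrableD => //; apply: integrableD => //.
  exact: (integrableZl measurableT 2 fg).
by apply/funext => x /=; rewrite -EFinM -!EFinD; congr EFin; ring.
Qed.

Lemma sq_integrable_sum (I : Type) (r : seq I) (P : pred I) (F : I -> T -> R) :
  (forall i, sq_integrable (F i)) ->
  sq_integrable (fun x => \sum_(i <- r | P i) F i x).
Proof.
move=> FL; elim: r => [|i r IH].
  rewrite (_ : (fun x => _) = cst 0); first exact: sq_integrable0.
  by apply/funext => x; rewrite big_nil.
rewrite (_ : (fun x => _) = if P i then
    (fun x => F i x + \sum_(j <- r | P j) F j x)
  else (fun x => \sum_(j <- r | P j) F j x)).
  by case: ifP => // Pi; exact: sq_integrableD.
by apply/funext => x; rewrite big_cons; case: ifP.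
Qed.

Lemma Rintegral_sum (I : Type) (r : seq I) (F : I -> T -> R) :
  (forall i, mu.-integrable setT (EFin \o F i)) ->
  \int[mu]_x (\sum_(i <- r) F i x) = \sum_(i <- r) \int[mu]_x F i x.
Proof.
move=> Fi; elim: r => [|i r IH].
  rewrite big_nil; under eq_Rintegral do rewrite big_nil.
  by rewrite /Rintegral integral0.
rewrite big_cons -IH; under eq_Rintegral do rewrite big_cons.
rewrite RintegralD//; rewrite (_ : EFin \o _ =
  fun x => (\sum_(i <- r) (F i x)%:E)%E).
  by apply: integrable_sum => // j _; exact: Fi.
by apply/funext => x /=; rewrite sumEFin.
Qed.

Lemma integrable_Rsum (I : Type) (r : seq I) (F : I -> T -> R) :
  (forall i, mu.-integrable setT (EFin \o F i)) ->
  mu.-integrable setT (EFin \o (fun x => \sum_(i <- r) F i x)).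
Proof.
move=> Fi; rewrite (_ : EFin \o _ = fun x => (\sum_(i <- r) (F i x)%:E)%E).
  by apply: integrable_sum => // j _; exact: Fi.
by apply/funext => x /=; rewrite sumEFin.
Qed.

Section orthonormal.
Variables (I : finType) (phi : I -> T -> R).
Hypothesis phiL : forall i, sq_integrable (phi i).
Hypothesis phi_ortho : forall i j,
  (\int[mu]_x (phi i x * phi j x)%:E = ((i == j)%:R)%:E)%E.

Definition coef f i : R := \int[mu]_x (f x * phi i x).

Lemma coef_lin (a : I -> R) i : coef (fun x => \sum_j a j * phi j x) i = a i.
Proof.
rewrite /coef; under eq_Rintegral do rewrite mulr_suml.
have int j : mu.-integrable setT (EFin \o (fun x => a j * phi j x * phi i x)).
  by apply: sq_integrableM => //; exact: sq_integrableZ.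
rewrite Rintegral_sum// (bigD1 i)//= big1 => [|j ji].
  under eq_Rintegral do rewrite -mulrA.
  rewrite RintegralZl//; last exact: sq_integrableM.
  by rewrite /Rintegral phi_ortho eqxx/= mulr1 addr0.
under eq_Rintegral do rewrite -mulrA.
rewrite RintegralZl//; last exact: sq_integrableM.
by rewrite /Rintegral phi_ortho (negbTE ji)/= mulr0.
Qed.

(** The coefficients of f give the best approximation, and Pythagoras' theorem
    measures the loss for other coefficients.  It is used both to compare the
    projection with a truncated expansion and to charge the error made on the
    coefficients. *)
Lemma Rintegral_sqr_sub f (a : I -> R) : sq_integrable f ->
  \int[mu]_x (f x - \sum_i a i * phi i x) ^+ 2 =
  \int[mu]_x (f x ^+ 2) - \sum_i coef f i ^+ 2 + \sum_i (coef f i - a i) ^+ 2.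
Proof.
move=> fL; pose g x := \sum_i a i * phi i x.
have gL : sq_integrable g.
  by apply: sq_integrable_sum => i; exact: sq_integrableZ.
have [mf fi] := fL; have [mg gi] := gL.
have crossE h : sq_integrable h ->
    \int[mu]_x (h x * g x) = \sum_i a i * coef h i.
  move=> hL; rewrite /g; under eq_Rintegral do rewrite mulr_sumr.
  rewrite Rintegral_sum; last first.
    by move=> i; apply: sq_integrableM => //; exact: sq_integrableZ.
  apply: eq_bigr => i _; under eq_Rintegral do rewrite mulrCA.
  by rewrite RintegralZl//; exact: sq_integrableM.
have -> : \int[mu]_x (f x - g x) ^+ 2 =
    \int[mu]_x (f x ^+ 2) - 2 * \int[mu]_x (f x * g x) + \int[mu]_x (g x * g x).
  rewrite -RintegralZl//; last exact: sq_integrableM.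
  have fgi : mu.-integrable setT (EFin \o (fun x => 2 * (f x * g x))).
    exact: (integrableZl measurableT 2 (sq_integrableM fL gL)).
  rewrite -RintegralB// -RintegralD//; last exact: (integrableB measurableT fi
      fgi).
  by apply: eq_Rintegral => x _; ring.
rewrite !crossE//.
under [X in _ + X]eq_bigr do rewrite /g coef_lin.
rewrite -[LHS]addrA -[RHS]addrA; congr (_ + _).
rewrite mulr_sumr -!sumrN -!big_split/=.
by apply: eq_bigr => i _; ring.
Qed.

Let n : R := #|I|%:R.
Hypothesis I_gt0 : (0 < #|I|)%N.

(** Divided by the number of functions this is a probability density.  Drawing
    points from it, rather than uniformly, is what bounds the variance of the
    estimates below although the functions phi i may be unbounded. *)
Definition christoffel x : R := \sum_i phi i x ^+ 2.

Lemma christoffel_ge0 x : 0 <= christoffel x.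
Proof. by apply: sumr_ge0 => i _; exact: sqr_ge0. Qed.

Lemma christoffel_eq0 x i : christoffel x = 0 -> phi i x = 0.
Proof.
move=> /eqP; rewrite psumr_eq0 => [/allP/(_ i)|? _]; last exact: sqr_ge0.
by rewrite mem_index_enum => /(_ isT) /=; rewrite sqrf_eq0 => /eqP.
Qed.

(** The importance-sampled estimate of the i-th coefficient of f from the
    single value f x. *)
Definition sample f x i : R := f x * (n * phi i x / christoffel x).

(** Equality holds where some phi i does not vanish, because the weights
    phi i ^ 2 / christoffel then sum to one.  Elsewhere all samples vanish and
    so does the density. *)
Lemma sample_density_le f (c : I -> R) x :
  (\sum_i (c i + sample f x i) ^+ 2) * (christoffel x / n) <=
  \sum_i c i ^+ 2 * (christoffel x / n) + 2 * (\sum_i c i * (f x * phi i x))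
   + n * f x ^+ 2.
Proof.
have n0 : 0 < n by rewrite ltr0n.
have [W0|W0] := eqVneq (christoffel x) 0.
  rewrite W0 mul0r mulr0 !big1 ?mulr0 ?add0r ?addr0.
  - by rewrite mulr_ge0 ?sqr_ge0// ltW.
  - by move=> i _; rewrite christoffel_eq0// !mulr0.
  - by move=> i _; rewrite mulr0.
rewrite le_eqVlt; apply/orP; left; apply/eqP.
have -> : n * f x ^+ 2 = \sum_i n * f x ^+ 2 * phi i x ^+ 2 / christoffel x.
  by rewrite -mulr_suml -mulr_sumr -/(christoffel x) mulfK.
rewrite mulr_suml mulr_sumr -!big_split/=; apply: eq_bigr => i _.
by rewrite /sample; field; rewrite W0 gt_eqF.
Qed.

Lemma Rintegral_christoffel : \int[mu]_x christoffel x = n.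
Proof.
rewrite Rintegral_sum; last by move=> i; have [] := phiL i.
rewrite (eq_bigr (fun=> 1)) ?sumr_const// => i _.
under eq_Rintegral do rewrite expr2.
by rewrite /Rintegral phi_ortho eqxx.
Qed.

Lemma measurable_christoffel : measurable_fun setT christoffel.
Proof.
apply: measurable_sum => i; apply: measurable_funX.
by have [] := phiL i.
Qed.

Lemma measurable_inv_christoffel :
  measurable_fun setT (fun x => (christoffel x)^-1).
Proof.
(* On the nonnegative reals the inverse is the power function of exponent -1. *)
rewrite (_ : (fun x => _) = (@powR R ^~ (- 1)) \o christoffel).
  by apply: measurableT_comp;
    [exact: measurable_powR|exact: measurable_christoffel].
by apply/funext => t; rewrite /= powRN powRr1// christoffel_ge0.
Qed.

(** With c i = s i - coef f i the bound reads sum_i s i ^ 2 + n |f|^2: adding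
    the centred estimate from one random point increases the squared error by
    at most n |f|^2 on average, since the cross terms cancel. *)
Lemma integral_sample_le f (c : I -> R) : sq_integrable f ->
  (\int[mu]_x ((\sum_i (c i + sample f x i) ^+ 2) * (christoffel x / n))%:E <=
   (\sum_i (c i + coef f i) ^+ 2 + n * \int[mu]_x (f x ^+ 2))%:E)%E.
Proof.
move=> fL; have [mf fi] := fL.
have n0 : 0 < n by rewrite ltr0n.
pose h x := \sum_i c i ^+ 2 * (christoffel x / n) + 2 * (\sum_i c i * (f x * phi
    i x))
   + n * f x ^+ 2.
have chi : mu.-integrable setT (EFin \o christoffel).
  by apply: integrable_Rsum => i; have [] := phiL i.
have i1 i : mu.-integrable setT (EFin \o (fun x => c i ^+ 2 * (christoffel x /
    n))).
  rewrite (_ : EFin \o _ = fun x => ((c i ^+ 2 / n)%:E * (christoffel x)%:E)%E).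
    exact: (integrableZl measurableT _ chi).
  by apply/funext => x /=; rewrite -EFinM mulrCA mulrC -mulrA.
have i2 i : mu.-integrable setT (EFin \o (fun x => c i * (f x * phi i x))).
  exact: (integrableZl measurableT _ (sq_integrableM fL (phiL i))).
have i2s : mu.-integrable setT (EFin \o (fun x => 2 * (\sum_i c i * (f x * phi i
    x)))).
  exact: (integrableZl measurableT 2 (integrable_Rsum _ i2)).
have i3 : mu.-integrable setT (EFin \o (fun x => n * f x ^+ 2)).
  exact: (integrableZl measurableT n fi).
have i12 := integrableD measurableT (integrable_Rsum (index_enum I) i1) i2s.
have hi : mu.-integrable setT (EFin \o h) := integrableD measurableT i12 i3.
apply: (@le_trans _ _ (\int[mu]_x (h x)%:E)%E).
  apply: ge0_le_integral => //.
  - move=> x _; rewrite lee_fin mulr_ge0//.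
      by apply: sumr_ge0 => i _; exact: sqr_ge0.
    by rewrite divr_ge0 ?christoffel_ge0// ltW.
  - apply/measurable_EFinP; apply: measurable_funM; last first.
      by apply: measurable_funM => //; exact: measurable_christoffel.
    apply: measurable_sum => i; apply: measurable_funX;
        apply: measurable_funD => //.
    apply: measurable_funM => //; apply: measurable_funM.
      by apply: measurable_funM => //; have [] := phiL i.
    exact: measurable_inv_christoffel.
  - by apply/measurable_EFinP; have /integrableP[/measurable_EFinP] := hi.
  - by move=> x _; rewrite lee_fin; exact: sample_density_le.
have -> : (\int[mu]_x (h x)%:E)%E = (\int[mu]_x h x)%:E.
  by rewrite /Rintegral fineK//; apply: integrable_fin_num.
rewrite lee_fin /h RintegralD// RintegralD//; last first.
  exact: integrable_Rsum.
have -> : \int[mu]_x (2 * \sum_i c i * (f x * phi i x)) =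
    2 * \int[mu]_x (\sum_i c i * (f x * phi i x)).
  exact: (RintegralZl 2 measurableT (integrable_Rsum (index_enum I) i2)).
have -> : \int[mu]_x (n * f x ^+ 2) = n * \int[mu]_x (f x ^+ 2).
  exact: (RintegralZl n measurableT fi).
rewrite !Rintegral_sum// lerD2r mulr_sumr -big_split/=; apply: ler_sum => i _.
rewrite RintegralZl//; last first.
  rewrite (_ : EFin \o _ = fun x => ((n^-1)%:E * (christoffel x)%:E)%E).
    exact: (integrableZl measurableT _ chi).
  by apply/funext => x /=; rewrite -EFinM mulrC.
rewrite RintegralZr// Rintegral_christoffel divff ?gt_eqF// mulr1.
rewrite RintegralZl//; last exact: sq_integrableM.
by rewrite -/(coef f i); have := sqr_ge0 (coef f i); nra.
Qed.

End orthonormal.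
End square_integrable.

(** * Greedy choice of sampling points *)

Section product_measurability.
Context d1 d2 (T : measurableType d1) (C : measurableType d2) (R : realType).

Lemma measurable_section1 (X : T -> C -> R) (t : C) :
  measurable_fun setT (fun p : T * C => X p.1 p.2) ->
  measurable_fun setT (fun w => X w t).
Proof. by move=> mX; exact: (measurableT_comp mX (pair2_measurable t)). Qed.

Lemma measurable_section2 (X : T -> C -> R) (w : T) :
  measurable_fun setT (fun p : T * C => X p.1 p.2) -> measurable_fun setT (X w).
Proof. by move=> mX; exact: (measurableT_comp mX (pair1_measurable w)). Qed.

Lemma measurable_integral2 (mu : probability C R) (f : T * C -> \bar R) :
  measurable_fun setT f -> (forall p, 0 <= f p)%E ->
  measurable_fun setT (fun w => \int[mu]_t f (w, t))%E.
Proof. exact: measurable_fun_fubini_tonelli_F. Qed.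

Lemma measurable_integral1 (P : probability T R) (f : T * C -> \bar R) :
  measurable_fun setT f -> (forall p, 0 <= f p)%E ->
  measurable_fun setT (fun t => \int[P]_w f (w, t))%E.
Proof. exact: measurable_fun_fubini_tonelli_G. Qed.

Lemma measurable_Rintegral2 (mu : probability C R) (f : T * C -> R) :
  measurable_fun setT f ->
  measurable_fun setT (fun w => \int[mu]_t f (w, t)).
Proof.
move=> mf; apply: measurableT_comp => //.
have mF : measurable_fun setT (EFin \o f) by exact/measurable_EFinP.
under eq_fun do rewrite integralE.
apply: emeasurable_funB.
  have := measurable_integral2 mu (measurable_funepos mF) (funepos_ge0 _).
  congr measurable_fun; apply/funext => w; apply: eq_integral => t _.
  by rewrite !funeposE.
have := measurable_integral2 mu (measurable_funeneg mF) (funeneg_ge0 _).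
congr measurable_fun; apply/funext => w; apply: eq_integral => t _.
by rewrite !funenegE.
Qed.

End product_measurability.

Section random_sampling.
Context d1 d2 (T : measurableType d1) (C : measurableType d2) (R : realType).
Variables (P : probability T R) (mu : probability C R).
Variables (X : T -> C -> R) (I : finType) (phi : I -> C -> R) (V : R) (G : C ->
    Prop).
Hypothesis mX : measurable_fun setT (fun p : T * C => X p.1 p.2).
Hypothesis phiL : forall i, sq_integrable mu (phi i).
Hypothesis phi_ortho : forall i j,
  (\int[mu]_x (phi i x * phi j x)%:E = ((i == j)%:R)%:E)%E.
Hypothesis I_gt0 : (0 < #|I|)%N.
Hypothesis V_gt0 : 0 < V.
Hypothesis XV : (\int[P]_w \int[mu]_t (X w t ^+ 2)%:E = V%:E)%E.
Hypothesis G_ae : {ae mu, forall t, G t}.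

Let n : R := #|I|%:R.
Let z i w : R := coef mu phi (X w) i.

Let mphi i : measurable_fun setT (phi i). Proof. by have [] := phiL i. Qed.

Let n_gt0 : 0 < n. Proof. by rewrite ltr0n. Qed.

Lemma measurable_coef i : measurable_fun setT (z i).
Proof.
apply: (@measurable_Rintegral2 _ _ _ _ _ mu (fun p => X p.1 p.2 * phi i p.2)).
by apply: measurable_funM => //; apply: measurableT_comp.
Qed.

Lemma measurable_energy : measurable_fun setT (fun w => \int[mu]_t (X w t ^+
    2)%:E)%E.
Proof.
apply: (measurable_integral2 mu (f := fun p => (X p.1 p.2 ^+ 2)%:E)) => //.
  by apply/measurable_EFinP; exact: measurable_funX.
by move=> p; rewrite lee_fin sqr_ge0.
Qed.

Lemma ae_sq_integrable : {ae P, forall w, sq_integrable mu (X w)}.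
Proof.
have : P.-integrable setT (fun w => \int[mu]_t (X w t ^+ 2)%:E)%E.
  apply/integrableP; split; first exact: measurable_energy.
  under eq_integral => w _.
    rewrite gee0_abs; last by apply: integral_ge0 => t _;
        rewrite lee_fin sqr_ge0.
    over.
  by rewrite XV ltry.
move=> /integrable_ae => /(_ measurableT).
apply: filterS => w /(_ Logic.I) fin; apply: sq_integrableP.
  exact: measurable_section2.
by rewrite ltey_eq fin.
Qed.

Let sampleX w t i : R := sample phi (X w) t i.

Let ratio i t : R := n * phi i t / christoffel phi t.

Let measurable_ratio i : measurable_fun setT (ratio i).
Proof.
apply: measurable_funM; first by apply: measurable_funM.
exact: measurable_inv_christoffel phiL.
Qed.

Let measurable_sampleX i : measurable_fun setT (fun p : T * C => sampleX p.1 p.2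
    i).
Proof.
apply: measurable_funM => //.
by apply: (measurableT_comp (measurable_ratio i)).
Qed.

Let measurable_sampleX1 t i : measurable_fun setT (fun w => sampleX w t i).
Proof.
exact: (@measurable_section1 _ _ _ _ _ (fun w t => sampleX w t i) t
  (measurable_sampleX i)).
Qed.

(** The average over t, for the density christoffel / n, of the new squared
    error is at most B + n V by [integral_sample_le] and Tonelli's theorem, so
    the error cannot exceed B + 2 n V at almost every t.  The factor 2 makes
    this contradiction strict, whatever the set G of full measure. *)
Lemma greedy_point (S : I -> T -> R) (B : R) :
  (forall i, measurable_fun setT (S i)) ->
  (\int[P]_w (\sum_i S i w ^+ 2)%:E <= B%:E)%E ->
  exists2 t, G t & (\int[P]_w
    (\sum_i (S i w - z i w + sampleX w t i) ^+ 2)%:E <= (B + 2 * n * V)%:E)%E.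
Proof.
move=> mS SB.
pose Q (p : T * C) := \sum_i (S i p.1 - z i p.1 + sampleX p.1 p.2 i) ^+ 2.
pose D t := (\int[P]_w (Q (w, t))%:E)%E.
have Q0 p : 0 <= Q p by apply: sumr_ge0 => i _; exact: sqr_ge0.
have mQ : measurable_fun setT Q.
  apply: measurable_sum => i; apply: measurable_funX; apply: measurable_funD.
    by apply: measurable_funB; [exact: (measurableT_comp (mS i))|
      exact: (measurableT_comp (measurable_coef i))].
  exact: measurable_sampleX.
have mEQ : measurable_fun setT (EFin \o Q) by exact/measurable_EFinP.
have mD : measurable_fun setT D.
  by apply: (measurable_integral1 P (f := EFin \o Q)).
have D0 t : (0 <= D t)%E by apply: integral_ge0 => w _; rewrite lee_fin.
have mW : measurable_fun setT (fun t => christoffel phi t / n).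
  by apply: measurable_funM => //; exact: measurable_christoffel phiL.
have W0 t : 0 <= christoffel phi t / n.
  by rewrite divr_ge0 ?christoffel_ge0// ltW.
have upper : (\int[mu]_t (D t * (christoffel phi t / n)%:E) <=
    (B + n * V)%:E)%E.
  pose f (p : T * C) := (Q p * (christoffel phi p.2 / n))%:E.
  have -> : (\int[mu]_t (D t * (christoffel phi t / n)%:E) =
      \int[mu]_t \int[P]_w f (w, t))%E.
    apply: eq_integral => t _; rewrite /D -ge0_integralZr//=.
    - exact/measurable_EFinP/(measurable_section1 (X := fun w t => Q (w, t))).
    - by move=> w _; rewrite lee_fin.
    - by rewrite lee_fin.
  rewrite -(@fubini_tonelli _ _ _ _ _ P mu f); last 2 first.
  - apply/measurable_EFinP; apply: measurable_funM => //.
    exact: (measurableT_comp mW).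
  - by move=> p; rewrite lee_fin mulr_ge0.
  have mSS : measurable_fun setT (fun w => \sum_i S i w ^+ 2).
    by apply: measurable_sum => i; exact: measurable_funX.
  apply: (@le_trans _ _ (\int[P]_w ((\sum_i S i w ^+ 2)%:E +
      n%:E * \int[mu]_t (X w t ^+ 2)%:E))%E).
    apply: ae_ge0_le_integral => //.
    - by move=> w _; apply: integral_ge0 => t _; rewrite lee_fin mulr_ge0.
    - apply: (measurable_integral2 mu (f := f)) => //.
        apply/measurable_EFinP; apply: measurable_funM => //.
        exact: (measurableT_comp mW).
      by move=> p; rewrite lee_fin mulr_ge0.
    - move=> w _; apply: adde_ge0.
        by rewrite lee_fin; apply: sumr_ge0 => i _; exact: sqr_ge0.
      apply: mule_ge0; first by rewrite lee_fin ltW.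
      by apply: integral_ge0 => t _; rewrite lee_fin sqr_ge0.
    - apply: emeasurable_funD; first exact/measurable_EFinP.
      by apply: emeasurable_funM => //; exact: measurable_energy.
    - move: ae_sq_integrable; apply: filterS => w wL _.
      have := integral_sample_le phiL phi_ortho I_gt0 (fun i => S i w - z i w)
          wL.
      rewrite /f /Q /=; under eq_bigr do rewrite subrK.
      have -> : (\int[mu]_t (X w t ^+ 2)%:E = (\int[mu]_t (X w t ^+ 2))%:E)%E.
        by rewrite /Rintegral fineK//; apply: integrable_fin_num => //;
          case: wL.
      by rewrite -EFinM -EFinD.
  rewrite ge0_integralD//; last 4 first.
  - by move=> w _; rewrite lee_fin; apply: sumr_ge0 => i _; exact: sqr_ge0.
  - exact/measurable_EFinP.
  - move=> w _; apply: mule_ge0; first by rewrite lee_fin ltW.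
    by apply: integral_ge0 => t _; rewrite lee_fin sqr_ge0.
  - by apply: emeasurable_funM => //; exact: measurable_energy.
  rewrite ge0_integralZl//; last 3 first.
  - exact: measurable_energy.
  - by move=> w _; apply: integral_ge0 => t _; rewrite lee_fin sqr_ge0.
  - by rewrite lee_fin ltW.
  by rewrite XV EFinD EFinM leeD2r.
apply: contrapT => /forall2NP noG.
have lower : ((B + 2 * n * V)%:E <=
    \int[mu]_t (D t * (christoffel phi t / n)%:E))%E.
  have B0 : 0 <= B.
    rewrite -lee_fin; apply: le_trans SB; apply: integral_ge0 => w _.
    by rewrite lee_fin; apply: sumr_ge0 => i _; exact: sqr_ge0.
  have K0 : 0 <= B + 2 * n * V by rewrite addr_ge0 ?mulr_ge0// ltW.
  have -> : (B + 2 * n * V)%:E =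
      (\int[mu]_t ((B + 2 * n * V)%:E * (christoffel phi t / n)%:E))%E.
    rewrite ge0_integralZl//; last 2 first.
    - exact/measurable_EFinP.
    - by move=> t _; rewrite lee_fin.
    have -> : (\int[mu]_t (christoffel phi t / n)%:E = 1)%E;
        last by rewrite mule1.
    under eq_integral do rewrite EFinM.
    have chi : mu.-integrable setT (EFin \o christoffel phi).
      by apply: integrable_Rsum => i; have [] := phiL i.
    rewrite integralZr//.
    have := Rintegral_christoffel phiL phi_ortho; rewrite /Rintegral => E.
    rewrite -[X in (X * _)%E]fineK; last exact: integrable_fin_num.
    by rewrite E -EFinM divff// gt_eqF.
  apply: ae_ge0_le_integral => //.
  - by move=> t _; rewrite mule_ge0// lee_fin.
  - by apply: emeasurable_funM => //; exact/measurable_EFinP.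
  - by move=> t _; rewrite mule_ge0// lee_fin.
  - by apply: emeasurable_funM => //; exact/measurable_EFinP.
  move: G_ae; apply: filterS => t Gt _.
  apply: lee_wpmul2r; first by rewrite lee_fin.
  by have [//|/negP] := noG t; rewrite -ltNge => /ltW.
have := le_trans lower upper; rewrite lee_fin.
by have := mulr_gt0 n_gt0 V_gt0; lra.
Qed.

Lemma greedy_points N : exists s : N.-tuple C,
  (forall l, G (tnth s l)) /\
  (\int[P]_w (\sum_i (\sum_(l < N) (sampleX w (tnth s l) i - z i w)) ^+ 2)%:E <=
   (2 * n * V * N%:R)%:E)%E.
Proof.
elim: N => [|N [s [sG sle]]].
  exists [tuple]; split; first by case.
  rewrite mulr0 integral0_eq// => w _.
  by rewrite big1// => i _; rewrite big_ord0 expr0n.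
have [|t Gt tle] := greedy_point _ sle.
  move=> i; apply: measurable_sum => l; apply: measurable_funB.
    exact: measurable_sampleX1.
  exact: measurable_coef.
exists [tuple of t :: s]; split.
  move=> l; case: (unliftP ord0 l) => [j ->|->]; last by rewrite tnth0.
  by rewrite tnthS.
have -> : 2 * n * V * N.+1%:R = 2 * n * V * N%:R + 2 * n * V.
  by rewrite -[N.+1%:R]natr1; ring.
apply: le_trans tle.
rewrite le_eqVlt; apply/orP; left; apply/eqP; apply: eq_integral => w _.
congr EFin; apply: eq_bigr => i _; congr (_ ^+ 2).
rewrite big_ord_recl tnth0; under [X in _ + X = _]eq_bigr do rewrite tnthS.
by rewrite addrC addrA addrAC.
Qed.

(** The function X is compared with an arbitrary element sum_i b i phi i of the
    span: the projection does at least as well, and the averaged estimates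
    differ from the exact coefficients by the greedy bound divided by N^2. *)
Lemma sampling_error N (b : I -> T -> R) : (0 < N)%N ->
  (forall i, measurable_fun setT (b i)) ->
  exists s : N.-tuple C, (forall l, G (tnth s l)) /\
  (\int[P]_w \int[mu]_t ((X w t - \sum_i ((\sum_(l < N)
       sampleX w (tnth s l) i) / N%:R) * phi i t) ^+ 2)%:E <=
   \int[P]_w \int[mu]_t ((X w t - \sum_i b i w * phi i t) ^+ 2)%:E +
     (2 * n * V / N%:R)%:E)%E.
Proof.
move=> N0 mb; have [s [sG sle]] := greedy_points N; exists s; split=> //.
pose a i w := (\sum_(l < N) sampleX w (tnth s l) i) / N%:R.
have NR : 0 < N%:R :> R by rewrite ltr0n.
have ma i : measurable_fun setT (a i).
  apply: measurable_funM => //; apply: measurable_sum => l.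
  exact: measurable_sampleX1.
have mres (c : I -> T -> R) : (forall i, measurable_fun setT (c i)) ->
    measurable_fun setT (fun p : T * C =>
      ((X p.1 p.2 - \sum_i c i p.1 * phi i p.2) ^+ 2)%:E).
  move=> mc; apply/measurable_EFinP; apply: measurable_funX;
      apply: measurable_funB => //.
  apply: measurable_sum => i; apply: measurable_funM.
    exact: (measurableT_comp (mc i)).
  exact: (measurableT_comp (mphi i)).
have mint (c : I -> T -> R) : (forall i, measurable_fun setT (c i)) ->
    measurable_fun setT (fun w => \int[mu]_t
      ((X w t - \sum_i c i w * phi i t) ^+ 2)%:E)%E.
  move=> mc; apply: (measurable_integral2 mu (mres c mc)) => p.
  by rewrite lee_fin sqr_ge0.
have maz : measurable_fun setT (fun w => (\sum_i (z i w - a i w) ^+ 2)%:E).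
  apply/measurable_EFinP; apply: measurable_sum => i; apply: measurable_funX.
  by apply: measurable_funB => //; exact: measurable_coef.
have az : (\int[P]_w (\sum_i (z i w - a i w) ^+ 2)%:E <=
    (2 * n * V / N%:R)%:E)%E.
  have -> : (\int[P]_w (\sum_i (z i w - a i w) ^+ 2)%:E = \int[P]_w
    ((N%:R ^- 2)%:E * (\sum_i (\sum_(l <
        N) (sampleX w (tnth s l) i - z i w)) ^+ 2)%:E))%E.
    apply: eq_integral => w _; rewrite -EFinM; congr EFin; rewrite mulr_sumr.
    apply: eq_bigr => i _; rewrite sumrB sumr_const card_ord /a -mulr_natr.
    by set u := \sum_(_ < _) _; field; rewrite gt_eqF.
  rewrite ge0_integralZl//; last 2 first.
  - apply/measurable_EFinP; apply: measurable_sum => i; apply: measurable_funX.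
    apply: measurable_sum => l; apply: measurable_funB.
      exact: measurable_sampleX1.
    exact: measurable_coef.
  - by move=> w _; rewrite lee_fin; apply: sumr_ge0 => i _; exact: sqr_ge0.
  have -> : (2 * n * V / N%:R)%:E = ((N%:R ^- 2)%:E * (2 * n * V * N%:R)%:E)%E.
    by rewrite -EFinM; congr EFin; field; rewrite gt_eqF.
  by apply: lee_wpmul2l => //; rewrite lee_fin invr_ge0 exprn_ge0.
apply: (@le_trans _ _ (\int[P]_w (\int[mu]_t ((X w t - \sum_i b i w * phi i t)
    ^+ 2)%:E
    + (\sum_i (z i w - a i w) ^+ 2)%:E))%E); last first.
  rewrite ge0_integralD//; first by rewrite leeD2l.
  - by move=> w _; apply: integral_ge0 => t _; rewrite lee_fin sqr_ge0.
  - exact: mint.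
  - by move=> w _; rewrite lee_fin; apply: sumr_ge0 => i _; exact: sqr_ge0.
apply: ae_ge0_le_integral => //.
- by move=> w _; apply: integral_ge0 => t _; rewrite lee_fin sqr_ge0.
- exact: mint.
- move=> w _; apply: adde_ge0.
    by apply: integral_ge0 => t _; rewrite lee_fin sqr_ge0.
  by rewrite lee_fin; apply: sumr_ge0 => i _; exact: sqr_ge0.
- by apply: emeasurable_funD => //; exact: mint.
move: ae_sq_integrable; apply: filterS => w wL _.
have E (c : I -> T -> R) : (\int[mu]_t ((X w t - \sum_i c i w * phi i t) ^+
    2)%:E =
    (\int[mu]_t (X w t - \sum_i c i w * phi i t) ^+ 2)%:E)%E.
  rewrite /Rintegral fineK//; apply: integrable_fin_num => //.
  have : sq_integrable mu (fun t => X w t + \sum_i (- c i w) * phi i t).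
    apply: sq_integrableD => //; apply: sq_integrable_sum => i.
    exact: sq_integrableZ.
  move=> [_]; apply: eq_integrable => // t _ /=; congr ((_ ^+ 2)%:E).
  by rewrite -sumrN; congr (_ + _); apply: eq_bigr => i _; rewrite mulNr.
rewrite E (E a) -EFinD lee_fin !(Rintegral_sqr_sub phiL phi_ortho _ wL).
rewrite -/(z _ w) lerD2r lerDl; apply: sumr_ge0 => i _; exact: sqr_ge0.
Qed.

End random_sampling.

(** * Tensor products on the cube *)

Section tensor.
Context {R : realType}.
Local Notation carrier := (measurableTypeR R).
Local Notation I01 := (@lebesgue01 R).

Lemma measurable_tensor d (F : 'I_d -> carrier -> R) :
  (forall l, measurable_fun setT (F l)) ->
  measurable_fun setT (fun t : d.-tuple carrier => \prod_(l <
      d) F l (tnth t l)).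
Proof.
move=> mF; apply: measurable_prod => l _.
exact: (measurableT_comp (mF l) (measurable_tnth l)).
Qed.

Lemma prod_tuple_cons_cube d (F : 'I_d.+1 -> carrier -> R) (p : carrier *
    d.-tuple carrier) :
  \prod_(l < d.+1) F l (tnth (tuple_cons p) l) =
  F ord0 p.1 * \prod_(l < d) F (lift ord0 l) (tnth p.2 l).
Proof.
rewrite big_ord_recl tnth0; congr (_ * _).
by apply: eq_bigr => l _; rewrite tnthS.
Qed.

(** Integrability comes from Tonelli's theorem and the value from Fubini's, by
    induction along the recursive definition of the measure on the cube. *)
Lemma tensor_integral d (F : 'I_d -> carrier -> R) :
  (forall l, I01.-integrable setT (EFin \o F l)) ->
  (lebesgue_cube R d).-integrable setT
    (fun t => (\prod_(l < d) F l (tnth t l))%:E) /\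
  (\int[lebesgue_cube R d]_t (\prod_(l < d) F l (tnth t l))%:E =
   (\prod_(l < d) \int[I01]_x F l x)%:E)%E.
Proof.
elim: d F => [|d IH] F Fi.
  split.
    rewrite (_ : (fun t => _) = cst (1 : R)%:E);
        first exact: finite_measure_integrable_cst.
    by apply/funext => t; rewrite big_ord0.
  under eq_integral do rewrite big_ord0.
  rewrite big_ord0 integral_cst//.
  rewrite [X in (_ * X)%E](@probability_setT _ _ _ (lebesgue_cube R 0)) mule1//.
have mF l : measurable_fun setT (F l).
  by have /integrableP[/measurable_EFinP] := Fi l.
have [IHi IHe] := IH (fun l => F (lift ord0 l)) (fun l => Fi _).
pose H (p : carrier * d.-tuple carrier) :=
  (F ord0 p.1 * \prod_(l < d) F (lift ord0 l) (tnth p.2 l))%:E.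
have mT : measurable_fun setT
    (fun t : d.+1.-tuple carrier => (\prod_(l < d.+1) F l (tnth t l))%:E).
  by apply/measurable_EFinP; exact: measurable_tensor.
have mH : measurable_fun setT H.
  apply/measurable_EFinP; apply: measurable_funM.
    exact: (measurableT_comp (mF ord0)).
  have := measurable_tensor (fun l : 'I_d => mF (lift ord0 l)).
  by move=> /measurableT_comp; apply.
have /integrableP[mP Pfin] := IHi.
have P0 : (0 <= \int[lebesgue_cube R d]_t
    `|(\prod_(l < d) F (lift ord0 l) (tnth t l))%:E|)%E by exact: integral_ge0.
have Hi : (I01 \x lebesgue_cube R d)%E.-integrable setT H.
  apply/integrable12ltyP => //.
  have E x : (\int[lebesgue_cube R d]_t `|H (x, t)| = `|(F ord0 x)%:E| *
     \int[lebesgue_cube R d]_t `|(\prod_(l <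
         d) F (lift ord0 l) (tnth t l))%:E|)%E.
    rewrite -ge0_integralZl//; last exact: measurableT_comp.
    by apply: eq_integral => t _; rewrite /H EFinM abseM.
  under eq_integral do rewrite E.
  have /integrableP[mF0 F0fin] := Fi ord0.
  rewrite ge0_integralZr//; last exact: measurableT_comp.
  by apply: lte_mul_pinfty => //; [exact: integral_ge0|rewrite ge0_fin_numE//;
    exact: integral_ge0].
have HE : (fun t => (\prod_(l < d.+1) F l (tnth t l))%:E) \o @tuple_cons R d =
    H.
  by apply/funext => p; rewrite /= prod_tuple_cons_cube.
have Hi' : (lebesgue01_prod (lebesgue_cube R d)).-integrable setT
  ((fun t => (\prod_(l < d.+1) F l (tnth t l))%:E) \o @tuple_cons R d).
  by rewrite HE; exact: Hi.
split; first exact: (integrable_pushforward (measurable_funPT (@tuple_cons R d))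
    mT Hi').
rewrite [LHS](integral_distribution mT Hi') HE.
transitivity (\int[(I01 \x lebesgue_cube R d)]_p H p)%E; first by [].
rewrite -(integral12_prod_meas1 Hi) big_ord_recl EFinM.
rewrite /fubini_F.
have E x : (\int[lebesgue_cube R d]_t H (x, t) = (F ord0 x)%:E *
   (\prod_(l < d) \int[I01]_x F (lift ord0 l) x)%:E)%E.
  by rewrite -IHe -integralZl.
under eq_integral do rewrite E.
rewrite integralZr//; last exact: Fi.
congr (_ * _)%E; rewrite /Rintegral fineK//.
by apply: integrable_fin_num => //; exact: Fi.
Qed.

End tensor.

Section orthonormal_tensors.
Context {R : realType}.
Local Notation carrier := (measurableTypeR R).
Variable phi : nat -> R -> R.
Hypothesis phi_ortho : orthonormal01 phi.

Definition tensor d (k : d.-tuple nat) (t : d.-tuple carrier) : R :=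
  \prod_(l < d) phi (tnth k l) (tnth t l).

Let phiL i : sq_integrable (@lebesgue01 R) (phi i).
Proof. by apply/sq_integrable_Lfun; have [] := phi_ortho. Qed.

Lemma tensor_ortho d (k j : d.-tuple nat) :
  (\int[lebesgue_cube R d]_t (tensor k t * tensor j t)%:E = ((k == j)%:R)%:E)%E.
Proof.
have phiM l : (@lebesgue01 R).-integrable setT
    (EFin \o (fun x => phi (tnth k l) x * phi (tnth j l) x)).
  exact: sq_integrableM.
have [_] := tensor_integral (fun l => phiM l).
under eq_integral do rewrite big_split/=.
move=> ->; congr EFin.
rewrite (eq_bigr (fun l => (tnth k l == tnth j l)%:R)); last first.
  by move=> l _; rewrite /Rintegral; have [_ ->] := phi_ortho.
have [->|kj] := eqVneq k j; first by rewrite big1// => l _; rewrite eqxx.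
have [l kjl] : exists l, tnth k l != tnth j l.
  apply/existsP; apply: contraNT kj; rewrite negb_exists => /forallP H.
  by apply/eqP/eq_from_tnth => l; have := H l; rewrite negbK => /eqP.
by rewrite (bigD1 l)//= (negbTE kjl) mul0r.
Qed.

Lemma tensor_sq_integrable d (k : d.-tuple nat) :
  sq_integrable (lebesgue_cube R d) (tensor k).
Proof.
apply: sq_integrableP.
  apply: (measurable_tensor (F := fun l => phi (tnth k l))) => l.
  by have [] := phiL (tnth k l).
under eq_integral do rewrite expr2.
by rewrite tensor_ortho ltry.
Qed.

(** The indicator function of the cube is a tensor product, of integral one. *)
Lemma ae_in_cube d : {ae lebesgue_cube R d, forall t : d.-tuple carrier,
  forall i, tnth t i \in `[0, 1]}.
Proof.
pose A := [set t : d.-tuple carrier | forall i, tnth t i \in `[0, 1]].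
have AE t : \1_A t = \prod_(i < d) (\1_(`[0, 1]%classic : set carrier) (tnth t
    i)) :> R.
  rewrite indicE; have [tA|tA] := pselect (A t).
    rewrite mem_set// big1// => i _; rewrite indicE mem_set//.
    exact: tA.
  rewrite memNset//.
  move: tA => /existsNP[i ti].
  by rewrite (bigD1 i)//= indicE memNset ?mul0r.
have mA : measurable A.
  rewrite (_ : A = (fun t => \prod_(i < d) (\1_(`[0, 1]%classic : set carrier)
      (tnth t i)))
      @^-1` [set 1 : R]).
    rewrite -[X in measurable X]setTI.
    have m1 (l : 'I_d) : measurable_fun setT (\1_(`[0, 1]%classic : set carrier)
        : carrier -> R).
      exact: measurable_indic.
    exact: (measurable_tensor m1 measurableT (measurable_set1 1)).
  apply/seteqP; split => t /=; rewrite -AE indicE.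
    by move=> tA; rewrite mem_set.
  by have [tA _|tA] := pselect (A t); rewrite // memNset// => /eqP;
    rewrite eq_sym oner_eq0.
have ii (l : 'I_d) : (@lebesgue01 R).-integrable setT
    (EFin \o (\1_(`[0, 1]%classic : set carrier) : carrier -> R)).
  by apply: integrable_indic => //; rewrite setTI.
have [_] := @tensor_integral R d (fun=> \1_(`[0, 1]%classic)) (fun l => ii l).
under eq_integral do rewrite -AE.
have L1 : @lebesgue01 R (`[0, 1]%classic : set carrier) = 1%E.
  rewrite /lebesgue01 /mrestr setIid.
  by rewrite lebesgue_measure_itv/= lte_fin ltr01 oppr0 adde0.
rewrite integral_indic// setIT big1 => [PA|l _]; last first.
  by rewrite /Rintegral integral_indic// setIT [X in fine X]L1.
exists (~` A); split => //; first exact: measurableC.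
by rewrite probability_setC// PA subee.
Qed.

End orthonormal_tensors.

(** * Countable sums and integrals *)

Section countable_esum.
Context {R : realType}.
Local Open Scope ereal_scope.

Lemma esum_pickle (K : countType) (g : K -> \bar R) : (forall k, 0 <= g k) ->
  \esum_(k in [set: K]) g k = \sum_(n <oo) oapp g 0 (@pickle_inv K n).
Proof.
move=> g0; have G0 n : 0 <= oapp g 0 (@pickle_inv K n)
    by case: pickle_inv => /=.
rewrite nneseries_esumT//.
transitivity (\esum_(n in choice.pickle @` [set: K]) oapp g 0 (@pickle_inv K
    n)).
  rewrite esum_image; last by move=> x y _ _; exact: (pcan_inj pickleK_inv).
  by apply: eq_esum => k _; rewrite pickleK_inv.
rewrite esum_mkcond; apply: eq_esum => n _.
case: ifPn => //; rewrite notin_setE => nK.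
case E : (@pickle_inv K n) => [k|//]; exfalso; apply: nK; exists k => //.
by have := @pickle_invK K n; rewrite E.
Qed.

(** An enumeration of the index type reduces this to monotone convergence for
    series. *)
Lemma integral_esum d (C : measurableType d) (mu : {measure set C -> \bar R})
    (K : countType) (A : set K) (f : K -> C -> \bar R) :
  (forall k, measurable_fun setT (f k)) -> (forall k x, 0 <= f k x) ->
  \int[mu]_x (\esum_(k in A) f k x) = \esum_(k in A) (\int[mu]_x f k x).
Proof.
move=> mf f0; rewrite esum_mkcond.
under eq_integral do rewrite esum_mkcond.
under eq_integral => x _.
  rewrite esum_pickle; last by move=> k; case: ifP.
  over.
rewrite esum_pickle; last first.
  by move=> k; case: ifP => // _; exact: integral_ge0.
rewrite integral_nneseries//.
- apply: eq_eseriesr => n _; case: pickle_inv => [k|] /=;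
    last by rewrite integral0.
  by case: (k \in A) => //; rewrite integral0.
- by move=> n; case: pickle_inv => [k|] //=; case: (k \in A).
- by move=> n x _; case: pickle_inv => [k|] //=; case: (k \in A).
Qed.

End countable_esum.

(** * Mean-square expansions in white noise *)

Section mean_square_expansion.
Context d (T : measurableType d) (R : realType) (P : probability T R) (J :
    choiceType).
Variables (xi : J -> {RV P >-> R}) (c : J -> R) (Y : T -> R).
Hypothesis xi_white : white_noise xi.
Hypothesis mY : measurable_fun setT Y.
Hypothesis Y_sum : mean_square_sum P (fun k w => c k * xi k w) Y.

Let xiL k : sq_integrable P (xi k).
Proof. by apply/sq_integrable_Lfun; have [] := xi_white. Qed.

Lemma white_noise_ortho k j :
  (\int[P]_w (xi k w * xi j w)%:E = ((k == j)%:R)%:E)%E.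
Proof.
have [_ xi0 xi1 xij] := xi_white.
have -> : (\int[P]_w (xi k w * xi j w)%:E = covariance P (xi k) (xi j))%E.
  rewrite covariance.unlock !xi0 unlock /=; apply: eq_integral => w _.
  by congr EFin; rewrite -[RHS]/((xi k w - 0) * (xi j w - 0)) !subr0.
have [->|kj] := eqVneq k j; first by rewrite -[LHS]/('V_P[xi j])%E xi1.
exact: xij.
Qed.

Let S (A : {fset J}) w := \sum_(k <- A) c k * xi k w.

Let mS A : measurable_fun setT (S A).
Proof. by apply: measurable_sum => k; apply: measurable_funM. Qed.

(** This is Pythagoras' theorem for white noise, read off from
    [Rintegral_sqr_sub] for the function zero. *)
Lemma partial_sum_norm (A : {fset J}) :
  (\int[P]_w (S A w ^+ 2)%:E = (\sum_(k <- A) c k ^+ 2)%:E)%E.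
Proof.
have SL : sq_integrable P (S A).
  by apply: sq_integrable_sum => k; exact: sq_integrableZ.
have ortho (i j : A) : (\int[P]_w (xi (val i) w * xi (val j) w)%:E =
    ((i == j)%:R)%:E)%E by rewrite white_noise_ortho val_eqE.
have := Rintegral_sqr_sub (fun i : A => xiL (val i)) ortho (fun i : A => - c
    (val i))
  (@sq_integrable0 _ _ _ P).
have coef0 (i : A) : coef P (fun i : A => xi (val i)) (cst 0) i = 0.
  rewrite /coef; under eq_Rintegral do rewrite mul0r.
  by rewrite /Rintegral integral0.
have I0 : \int[P]_w ((cst 0 w : R) ^+ 2) = 0.
  by under eq_Rintegral do rewrite expr0n; rewrite /Rintegral integral0.
rewrite I0 [X in _ - X]big1 => [|i _]; last by rewrite coef0 expr0n.
rewrite subrr add0r (eq_bigr (fun i : A => c (val i) ^+ 2)); last first.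
  by move=> i _; rewrite coef0 opprK add0r.
rewrite big_seq_fsetE/= => <-; rewrite /Rintegral fineK.
  apply: eq_integral => w _; congr ((_ ^+ 2)%:E).
  rewrite /S big_seq_fsetE/= -sumrN add0r; apply: eq_bigr => i _.
  by rewrite mulNr opprK.
apply: integrable_fin_num => //.
have [_] := SL; apply: eq_integrable => // w _ /=; congr ((_ ^+ 2)%:E).
rewrite /S big_seq_fsetE/= -sumrN add0r; apply: eq_bigr => i _.
by rewrite mulNr opprK.
Qed.

(** A form of the triangle inequality in L_2 that stays linear in the squared
    norms, so that it makes sense for infinite values. *)
Lemma sqr_triangle (u v : T -> R) (dl : R) : 0 < dl ->
  measurable_fun setT u -> measurable_fun setT v ->
  (\int[P]_w ((u w + v w) ^+ 2)%:E <=
   (1 + dl)%:E * \int[P]_w (u w ^+ 2)%:E + (1 + dl^-1)%:E * \int[P]_w (v w ^+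
       2)%:E)%E.
Proof.
move=> dl0 mu mv.
have d1 : 0 <= 1 + dl by rewrite addr_ge0// ltW.
have d2 : 0 <= 1 + dl^-1 by rewrite addr_ge0// invr_ge0 ltW.
have mEu : measurable_fun setT (fun w => (u w ^+ 2)%:E).
  by apply/measurable_EFinP; exact: measurable_funX.
have mEv : measurable_fun setT (fun w => (v w ^+ 2)%:E).
  by apply/measurable_EFinP; exact: measurable_funX.
rewrite -!ge0_integralZl//; do ?by move=> w _; rewrite lee_fin sqr_ge0.
rewrite -ge0_integralD//; last 4 first.
- by move=> w _; rewrite mule_ge0// lee_fin ?sqr_ge0.
- exact: emeasurable_funM.
- by move=> w _; rewrite mule_ge0// lee_fin ?sqr_ge0.
- exact: emeasurable_funM.
apply: ge0_le_integral => //.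
- by move=> w _; rewrite lee_fin sqr_ge0.
- by apply/measurable_EFinP; apply: measurable_funX; exact: measurable_funD.
- by apply: emeasurable_funD; exact: emeasurable_funM.
- move=> w _; rewrite -!EFinM -EFinD lee_fin -subr_ge0.
  have -> : (1 + dl) * u w ^+ 2 + (1 + dl^-1) * v w ^+ 2 - (u w + v w) ^+ 2 =
      dl * (u w - v w / dl) ^+ 2 by field; rewrite gt_eqF.
  by rewrite mulr_ge0 ?sqr_ge0// ltW.
Qed.

(** First et tends to 0, then dl. *)
Lemma lee_sqr_approx (x y : \bar R) : (0 <= y)%E ->
  (forall dl et : R, (0 < dl)%R -> (0 < et)%R ->
     x <= (1 + dl)%:E * y + ((1 + dl^-1) * et)%:E)%E -> (x <= y)%E.
Proof.
case: y => [y|_ _|//]; last exact: leey.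
rewrite lee_fin => y0 H; apply/lee_addgt0Pr => e e0.
have y1 : 0 < 2 * (y + 1) by lra.
pose dl := e / (2 * (y + 1)).
have dl0 : 0 < dl by rewrite divr_gt0.
have k0 : 0 < 1 + dl^-1 by rewrite addr_gt0 ?invr_gt0.
have et0 : 0 < e / 2 / (1 + dl^-1) by rewrite divr_gt0// divr_gt0.
apply: le_trans (H _ _ dl0 et0) _.
rewrite -EFinM -!EFinD lee_fin mulrCA divff ?gt_eqF// mulr1 mulrDl mul1r.
have : dl * y <= e / 2.
  have -> : e / 2 = dl * (y + 1) by rewrite /dl; field; lra.
  by rewrite ler_pM2l//; lra.
by lra.
Qed.

Let res A : \bar R := (\int[P]_w ((Y w - S A w) ^+ 2)%:E)%E.

Lemma residual_small (A : {fset J}) (et : R) : 0 < et ->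
  exists2 F, (A `<=` F)%fset & (res F <= et%:E)%E.
Proof.
move=> et0.
have tot := @summability.totally_filter J.
have res_fin := Y_sum.
move: res_fin => /fine_cvgP [res_fin res_cvg].
have small : \forall F \near @summability.totally J, (res F <= et%:E)%E.
  near=> F.
  have Ffin : res F \is a fin_num.
    rewrite /res; near: F; move: res_fin; apply: filterS => F; rewrite unlock.
    by [].
  rewrite -(fineK Ffin) lee_fin.
  rewrite /res; near: F; move/cvgr_le : res_cvg => /(_ et et0).
  by apply: filterS => F; rewrite unlock.
have [A0 _ A0small] := small.
exists (A0 `|` A)%fset; first exact: fsubsetUr.
by apply: A0small; exact: fsubsetUl.
Unshelve. all: by end_near. Qed.

Let S_split (A F : {fset J}) w : (A `<=` F)%fset ->
  S F w = S A w + S (F `\` A)%fset w.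
Proof.
move=> AF; rewrite /S (big_fsetID _ (mem A)) /=; congr (_ + _).
  by apply: eq_fbigl => k; rewrite !inE/=;
    case: (boolP (k \in A)) => [/(fsubsetP AF)->|]; rewrite ?andbF.
by apply: eq_fbigl => k; rewrite !inE/= andbC.
Qed.

(** For F containing A, the residual at A is the sum over F minus A up to the
    residual at F, which tends to zero along the filter of finite sets.  The
    triangle inequality is applied in both directions. *)
Lemma residualE (A : {fset J}) :
  res A = (\esum_(k in ~` [set` A]) (c k ^+ 2)%:E)%E.
Proof.
have c2 k : (0 <= (c k ^+ 2)%:E)%E by rewrite lee_fin sqr_ge0.
have res0 B : (0 <= res B)%E.
  by apply: integral_ge0 => w _; rewrite lee_fin sqr_ge0.
apply/eqP; rewrite eq_le; apply/andP; split.
  apply: lee_sqr_approx => [|dl et dl0 et0]; first exact: esum_ge0.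
  have [F AF Fet] := residual_small A et0.
  have -> : res A = (\int[P]_w ((S (F `\` A)%fset w + (Y w - S F w)) ^+
      2)%:E)%E.
    apply: eq_integral => w _; congr ((_ ^+ 2)%:E).
    by rewrite (S_split w AF); ring.
  apply: (le_trans (sqr_triangle dl0 (mS _) _)); first exact: measurable_funB.
  rewrite EFinM; apply: leeD; apply: lee_wpmul2l => //.
  - by rewrite lee_fin addr_ge0// ltW.
  - rewrite partial_sum_norm; apply: esum_ge; exists [set` (F `\` A)%fset].
      split => // k; rewrite /= !inE => /andP[/negP kA _]; exact: kA.
    by rewrite fsbig_finite//= set_fsetK sumEFin.
  - by rewrite lee_fin addr_ge0// invr_ge0 ltW.
apply: ge_ereal_sup => _ [B [finB BA] <-].
rewrite fsbig_finite//= sumEFin.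
apply: lee_sqr_approx => // dl et dl0 et0.
have [F ABF Fet] := residual_small (A `|` fset_set B)%fset et0.
have AF : (A `<=` F)%fset by apply: fsubset_trans ABF; exact: fsubsetUl.
apply: (@le_trans _ _ (\sum_(k <- (F `\` A)%fset) c k ^+ 2)%:E).
  rewrite lee_fin [leRHS](big_fsetID _ (mem (fset_set B)))/=.
  rewrite -[leLHS]addr0; apply: lerD; last by apply: sumr_ge0 => k _;
      exact: sqr_ge0.
  rewrite le_eqVlt; apply/orP; left; apply/eqP; apply: eq_fbigl => k.
  rewrite !inE/=; case: (boolP (k \in fset_set B)) => kB; last by rewrite andbF.
  rewrite andbT (fsubsetP ABF) ?inE ?kB ?orbT// andbT.
  by apply/esym/negP => kA; apply: (BA k) => //; move: kB;
    rewrite in_fset_set// inE.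
rewrite -partial_sum_norm.
have -> : (\int[P]_w (S (F `\` A)%fset w ^+ 2)%:E =
    \int[P]_w ((Y w - S A w + - (Y w - S F w)) ^+ 2)%:E)%E.
  apply: eq_integral => w _; congr ((_ ^+ 2)%:E).
  by rewrite (S_split w AF); ring.
apply: (le_trans (sqr_triangle dl0 _ _)).
- exact: measurable_funB.
- by apply: measurableT_comp => //; exact: measurable_funB.
rewrite EFinM leeD2l//; apply: lee_wpmul2l.
  by rewrite lee_fin addr_ge0// invr_ge0 ltW.
by under eq_integral do rewrite sqrrN.
Qed.

End mean_square_expansion.

(** * The approximation procedure *)

Section field_energy.
Context {R : realType}.
Local Notation carrier := (measurableTypeR R).

Lemma measurable_esum d (C : measurableType d) (K : countType) (A : set K)
    (f : K -> C -> \bar R) :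
  (forall k, measurable_fun setT (f k)) -> (forall k x, 0 <= f k x)%E ->
  measurable_fun setT (fun x => \esum_(k in A) f k x)%E.
Proof.
move=> mf f0.
rewrite (_ : (fun x => _) = fun x => (\sum_(n <oo) oapp (fun k => if k \in A
    then f k x else 0)
    0 (@pickle_inv K n))%E); last first.
  apply/funext => x; rewrite esum_mkcond esum_pickle// => k.
  by case: ifP.
apply: ge0_emeasurable_sum => [n x _ _|n _].
  by case: pickle_inv => [k|] //=; case: ifP.
by case: pickle_inv => [k|] //=; case: (k \in A).
Qed.

Lemma mean_sqnormE (d : nat) (disp : measure_display) (T : measurableType disp)
    (P : probability T R) (Y : T -> d.-tuple carrier -> R) :
  mean_sqnorm P Y = (\int[P]_w \int[lebesgue_cube R d]_t (Y w t ^+ 2)%:E)%E.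
Proof.
apply: eq_integral => w _.
have := @powR_Lnorm _ _ R (lebesgue_cube R d) (EFin \o Y w) 2.
rewrite pnatr_eq0 => /(_ isT).
have poweR2 (x : \bar R) : (0 <= x -> x `^ 2 = x ^+ 2)%E.
  case: x => [r|_|//]; last by rewrite poweRyr ?pnatr_eq0.
  by rewrite lee_fin => r0; rewrite poweR_EFin powR_mulrn// EFin_expe.
rewrite poweR2 ?Lnorm_ge0// => ->; apply: eq_integral => t _ /=.
by rewrite powR_mulrn// real_normK ?num_real.
Qed.

Variables (phi : nat -> R -> R) (lam : nat -> R) (d : nat).
Variables (disp : measure_display) (T : measurableType disp) (P : probability T
    R).
Variables (xi : d.-tuple nat -> {RV P >-> R}) (X : T -> d.-tuple carrier -> R).
Hypothesis hphi : orthonormal01 phi.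
Hypothesis hxi : white_noise xi.
Hypothesis hX : KL_field lam phi xi X.

Let lamd (k : d.-tuple nat) : R := \prod_(l < d) lam (tnth k l).

Let mX : measurable_fun setT (fun p : T * d.-tuple carrier => X p.1 p.2).
Proof. by case: hX. Qed.

Let mtensor (k : d.-tuple nat) : measurable_fun setT (tensor phi k).
Proof. by have [] := tensor_sq_integrable hphi k. Qed.

(** For almost every t the error at t is the tail of the series of the squares
    of lam_k phi_k(t), by [residualE]; these functions of t have integrals
    lam_k^2. *)
Lemma truncation_error (A : {fset d.-tuple nat}) :
  (\int[P]_w \int[lebesgue_cube R d]_t
    ((X w t - \sum_(k <- A) lamd k * tensor phi k t * xi k w) ^+ 2)%:E =
   \esum_(k in ~` [set` A]) (lamd k ^+ 2)%:E)%E.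
Proof.
pose f (p : T * d.-tuple carrier) :=
  ((X p.1 p.2 - \sum_(k <- A) lamd k * tensor phi k p.2 * xi k p.1) ^+ 2)%:E.
have f0 p : (0 <= f p)%E by rewrite lee_fin sqr_ge0.
have mf : measurable_fun setT f.
  apply/measurable_EFinP; apply: measurable_funX; apply: measurable_funB => //.
  apply: measurable_sum => k; apply: measurable_funM.
    by apply: measurable_funM => //; exact: (measurableT_comp (mtensor k)).
  exact: (measurableT_comp (measurable_funPT (xi k))).
rewrite (@fubini_tonelli _ _ _ _ _ P (lebesgue_cube R d) f)//.
have mc k : measurable_fun setT (fun t => ((lamd k * tensor phi k t) ^+ 2)%:E).
  by apply/measurable_EFinP; apply: measurable_funX; exact: measurable_funM.
transitivity (\int[lebesgue_cube R d]_t (\esum_(k in ~` [set` A])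
    ((lamd k * tensor phi k t) ^+ 2)%:E))%E.
  apply: ge0_ae_eq_integral => //.
  - exact: measurable_integral1.
  - by apply: measurable_esum => // k t; rewrite lee_fin sqr_ge0.
  - by move=> t _; exact: integral_ge0.
  - by move=> t _; apply: esum_ge0 => k _; rewrite lee_fin sqr_ge0.
  case: hX => _; apply: filterS.
    exact: (ae_filter_ringOfSetsType (lebesgue_cube R d)).
  move=> t Xt _.
  exact: (residualE hxi (measurable_section1 t mX) Xt A).
rewrite integral_esum//; last by move=> k t; rewrite lee_fin sqr_ge0.
apply: eq_esum => k _.
under eq_integral do rewrite exprMn EFinM.
rewrite ge0_integralZl//.
- under eq_integral do rewrite expr2.
  by rewrite tensor_ortho// eqxx mule1.
- by apply/measurable_EFinP; exact: measurable_funX.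
- by move=> t _; rewrite lee_fin sqr_ge0.
- by rewrite lee_fin sqr_ge0.
Qed.

Hypothesis cvg_Lambda : cvgn (series (fun i => lam i ^+ 2)).
Hypothesis Lambda_gt0 : 0 < Lambda lam.

Lemma field_energy :
  (\int[P]_w \int[lebesgue_cube R d]_t (X w t ^+ 2)%:E =
      (Lambda lam ^+ d)%:E)%E.
Proof.
have := truncation_error fset0.
under eq_integral do under eq_integral do rewrite big_seq_fset0 subr0.
move=> ->; rewrite -(esum_eigenvalues cvg_Lambda d); congr esum.
by apply/seteqP; split => // k _ /=; rewrite inE.
Qed.

(** The error is at most e2 V for the projection plus 2 n V / N <= 2 e2 V for
    the estimation of the coefficients, where V is the energy of the field.
    The weights of the procedure are obtained by exchanging the sum over the
    indices with the sum over the points. *)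
Lemma exists_procedure (e2 : R) (F : {fset d.-tuple nat}) (N : nat) :
  small_tail lam e2 F -> (0 < #|` F|)%N -> (0 < N)%N ->
  #|` F|%:R <= e2 * N%:R ->
  exists A : point_procedure R d N,
    (mean_sqnorm P (fun w => (X w \- proc_map A (X w))%R) <=
      (3 * e2)%:E * mean_sqnorm P X)%E.
Proof.
move=> Ftail F0 N0 FN.
pose V := Lambda lam ^+ d.
have V0 : 0 < V by rewrite exprn_gt0.
have phiF (k : F) := tensor_sq_integrable hphi (val k).
have orthoF (k j : F) : (\int[lebesgue_cube R d]_t
    (tensor phi (val k) t * tensor phi (val j) t)%:E = ((k == j)%:R)%:E)%E.
  by rewrite tensor_ortho// val_eqE.
have F0' : (0 < #|{: F}|)%N by rewrite -cardfE.
have [|s [sG sle]] := @sampling_error _ _ _ _ _ P (lebesgue_cube R d) X _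
  (fun k : F => tensor phi (val k)) V (fun t => forall i, tnth t i \in `[0, 1])
  mX phiF orthoF F0' V0 field_energy (@ae_in_cube R d) N
  (fun (k : F) w => lamd (val k) * xi (val k) w) N0.
  by move=> k; apply: measurable_funM.
pose ratio (k : F) t : R := #|{: F}|%:R * tensor phi (val k) t /
  christoffel (fun k : F => tensor phi (val k)) t.
pose psi (l : 'I_N) (t : d.-tuple carrier) : R :=
  \sum_(k : F) (ratio k (tnth s l) / N%:R) * tensor phi (val k) t.
have psiL l : psi l \in Lfun (lebesgue_cube R d) 2%:E.
  apply/sq_integrable_Lfun; apply: sq_integrable_sum => k.
  exact: sq_integrableZ.
exists (PointProcedure sG psiL); rewrite !mean_sqnormE field_energy.
have -> : (\int[P]_w \int[lebesgue_cube R d]_t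
    ((X w \- proc_map (PointProcedure sG psiL) (X w)) t ^+ 2)%:E =
  \int[P]_w \int[lebesgue_cube R d]_t ((X w t - \sum_(k : F)
     ((\sum_(l < N) sample (fun k : F => tensor phi (val k)) (X w) (tnth s l) k)
        / N%:R) * tensor phi (val k) t) ^+ 2)%:E)%E.
  apply: eq_integral => w _; apply: eq_integral => t _; congr ((_ ^+ 2)%:E).
  rewrite /=; congr (_ - _); rewrite /proc_map /= /psi.
  under eq_bigr do rewrite mulr_sumr.
  rewrite exchange_big/=; apply: eq_bigr => k _.
  rewrite !mulr_suml; apply: eq_bigr => l _.
  by rewrite /sample /ratio; ring.
apply: (le_trans sle).
have -> : (\int[P]_w \int[lebesgue_cube R d]_t ((X w t - \sum_(k : F)
     (lamd (val k) * xi (val k) w) * tensor phi (val k) t) ^+ 2)%:E =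
   \esum_(k in ~` [set` F]) (lamd k ^+ 2)%:E)%E.
  rewrite -truncation_error; apply: eq_integral => w _;
      apply: eq_integral => t _.
  congr ((_ ^+ 2)%:E); rewrite big_seq_fsetE/=; congr (_ - _).
  by apply: eq_bigr => k _; rewrite mulrAC.
apply: (le_trans (leeD2r _ Ftail)).
rewrite -EFinD -EFinM lee_fin.
have NR : 0 < N%:R :> R by rewrite ltr0n.
have : #|{: F}|%:R * V / N%:R <= e2 * V.
  rewrite mulrAC ler_pM2r// ler_pdivrMr//.
  by move: FN; rewrite cardfE.
rewrite -/V; lra.
Qed.

End field_energy.

Theorem proposition3p5 (R : realType) (phi : nat -> R -> R) (lam : nat -> R)
  (disp : nat -> measure_display)
  (Omega : forall d : nat, measurableType (disp d))
  (P : forall d : nat, probability (Omega d) R)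
  (xi : forall d : nat, d.-tuple nat -> {RV (P d) >-> R})
  (X : forall d : nat, Omega d -> d.-tuple (measurableTypeR R) -> R)
  (hphi : orthonormal01 phi)
  (hlam : forall i : nat, 0 <= lam i)
  (hLambda : cvgn (series (fun i => lam i ^+ 2)))
  (hLambda_gt0 : 0 < Lambda lam)
  (hM2 : cvgn (series (M2_terms lam)))
  (hsigma2_gt0 : 0 < sigma2 lam)
  (hxi : forall d : nat, (0 < d)%N -> white_noise (xi d))
  (hX : forall d : nat, (0 < d)%N -> KL_field lam phi (xi d) (X d))
  (eps q : R) (heps : 0 < eps < 1)
  (hq : Phihat (q / sigma lam) = eps ^+ 2) :
  exists (m : nat -> nat) (A : forall d : nat, point_procedure R d (m d)),
    [/\ forall d : nat, (0 < d)%N -> (0 < m d)%N,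
        forall d : nat, (0 < d)%N ->
          (mean_sqnorm (P d) (fun w => (X d w \- proc_map (A d) (X d w))%R) <=
           (3 * eps ^+ 2)%:E * mean_sqnorm (P d) (X d))%E
      & (fun d : nat =>
           (ln ((m d)%:R : R) - d%:R * ln (Lambda_star lam)) / Num.sqrt d%:R)
          @ \oo --> 2 * q].
Proof.
have [F [m [Ftail F0 m0 Fm mlim]]] :=
  sampling_sizes hlam hLambda hLambda_gt0 hM2 hsigma2_gt0 heps hq.
have procedures d : exists A : point_procedure R d (m d), (0 < d)%N ->
    (mean_sqnorm (P d) (fun w => (X d w \- proc_map A (X d w))%R) <=
      (3 * eps ^+ 2)%:E * mean_sqnorm (P d) (X d))%E.
  case: d => [|d]; last first.
    have [A AE] := exists_procedure hphi (hxi d.+1 isT) (hX d.+1 isT) hLambda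
        hLambda_gt0
      (Ftail d.+1) (F0 d.+1) (m0 d.+1) (Fm d.+1).
    by exists A.
  have node0 (l : 'I_(m 0)) i : tnth ([tuple] : 0.-tuple (measurableTypeR R)) i
      \in `[0, 1].
    by case: i.
  have weight0 (l : 'I_(m 0)) : cst 0 \in Lfun (lebesgue_cube R 0) 2%:E.
    by apply/sq_integrable_Lfun; exact: sq_integrable0.
  by exists (PointProcedure node0 weight0).
exists m, (fun d => sval (cid (procedures d))); split=> // d d0.
by case: cid => A /= /(_ d0).
Qed.
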